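(* Let $n\in\{1,2\}$, $\varepsilon>0$, $\lambda>0$, and let $u^0,u^1\in C^\infty(X^n)$ satisfy $D_x^2u^0+I_n\ge\lambda I_n$ and $D_x^2u^1+I_n\ge\lambda I_n$ on $X^n$. Let $u\in C^\infty(X^n\times[0,1])$ be the solution of the Donaldson equation $$u_{tt}(n+\Delta u)-\sum_{j=1}^n u_{jt}^2=\varepsilon\quad\text{on }X^n\times T,$$ with $n+\Delta u\ge0$ and Dirichlet data $u(x,0)=u^0(x)$, $u(x,1)=u^1(x)$. Then for all $(x,t)\in X^n\times T$, $$D_x^2u(x,t)+I_n\ge\lambda I_n,$$ with the same $\lambda$ (in particular the lower bound does not depend on $\varepsilon$).
   Context: $X^n=(\mathbf R/\mathbf Z)^n$ is the $n$-dimensional flat torus with coordinates $x=(x_1,\dots,x_n)$, and $T=(0,1)$ with coordinate $t$. $D_x^2u$ is the $n\times n$ Hessian of $u$ in the $x$ variables, $\Delta u=\sum_{j=1}^n u_{jj}$ is the Laplacian in the $x$ variables only, subscripts denote partial derivatives ($u_{jt}=\partial_{x_j}\partial_tu$), and $I_n$ is the $n\times n$ identity matrix. Matrix inequalities are in the sense of symmetric matrices. For $\varepsilon>0$ it is known that the Dirichlet problem has a unique smooth solution with $n+\Delta u\ge0$. *)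

(* Defs.v *)
From HB Require Import structures.
From mathcomp Require Import all_boot all_order all_algebra.
From mathcomp Require Import all_classical all_reals all_analysis.

Set Implicit Arguments.
Unset Strict Implicit.
Unset Printing Implicit Defensive.

Import Order.TTheory GRing.Theory Num.Theory.
Import numFieldNormedType.Exports.

Local Open Scope classical_set_scope.
Local Open Scope ring_scope.

(* [Ck k U f]: on the open set [U], all iterated directional derivatives of [f]
   of order at most [k] exist and are continuous. The normed space [V] is meant
   to be finite-dimensional (below, R^n or R^n x R); letting the directions
   range over all of [V] avoids the choice of coordinates. *)
Fixpoint Ck (R : realType) (V : normedModType R) (k : nat) (U : set V)
    (f : V -> R) : Prop :=
  (forall x, U x -> {for x, continuous f}) /\
  match k with
  | 0 => True
  | k'.+1 => forall v : V,
      (forall x, U x -> derivable f x v) /\ Ck k' U ('D_v f)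
  end.

Definition smooth_open (R : realType) (V : normedModType R) (U : set V)
    (f : V -> R) : Prop :=
  forall k, Ck k U f.

(* Smoothness on an arbitrary subset [A], e.g. a closed slab (smoothness up to
   the boundary): near every point of [A], [f] coincides on [A] with a function
   that is smooth on an open set. *)
Definition smooth_on (R : realType) (V : normedModType R) (A : set V)
    (f : V -> R) : Prop :=
  forall p, A p -> exists (U : set V) (F : V -> R),
    [/\ open U, U p, smooth_open U F & forall q, U q -> A q -> F q = f q].

(* Functions on the torus (R/Z)^n are represented by Z^n-periodic functions
   on R^n. *)
Definition Zperiodic (R : realType) (n : nat) (f : 'rV[R]_n -> R) : Prop :=
  forall (k : 'rV[int]_n) (x : 'rV[R]_n), f (x + map_mx intr k) = f x.

Definition smooth_torus (R : realType) (n : nat) (f : 'rV[R]_n -> R) : Prop :=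
  Zperiodic f /\ smooth_open setT f.

(* C^oo(X^n x [0,1]); the values of [u] at points (x, t) with t outside [0,1]
   are irrelevant. *)
Definition smooth_cylinder (R : realType) (n : nat)
    (u : 'rV[R]_n * R -> R) : Prop :=
  (forall t, 0 <= t <= 1 -> Zperiodic (fun x => u (x, t))) /\
  smooth_on [set p : 'rV[R]_n * R | 0 <= p.2 <= 1] u.

Definition basis_vec (R : realType) (n : nat) (j : 'I_n) : 'rV[R]_n :=
  delta_mx 0 j.

Definition hessian (R : realType) (n : nat) (f : 'rV[R]_n -> R)
    (x : 'rV[R]_n) : 'M[R]_n :=
  \matrix_(i, j) 'D_(basis_vec R j) ('D_(basis_vec R i) f) x.

Definition dx (R : realType) (n : nat) (j : 'I_n) (u : 'rV[R]_n * R -> R) :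
    'rV[R]_n * R -> R :=
  'D_((basis_vec R j, 0) : 'rV[R]_n * R) u.

Definition dt (R : realType) (n : nat) (u : 'rV[R]_n * R -> R) :
    'rV[R]_n * R -> R :=
  'D_((0, 1) : 'rV[R]_n * R) u.

Definition hessian_x (R : realType) (n : nat) (u : 'rV[R]_n * R -> R)
    (p : 'rV[R]_n * R) : 'M[R]_n :=
  \matrix_(i, j) dx j (dx i u) p.

Definition laplacian_x (R : realType) (n : nat) (u : 'rV[R]_n * R -> R)
    (p : 'rV[R]_n * R) : R :=
  \sum_(j < n) dx j (dx j u) p.

Definition psd (R : realType) (n : nat) (A : 'M[R]_n) : Prop :=
  A^T = A /\ forall v : 'rV[R]_n, 0 <= (v *m A *m v^T) 0 0.

Definition mx_ge (R : realType) (n : nat) (A B : 'M[R]_n) : Prop :=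
  psd (A - B).

Definition donaldson_op (R : realType) (n : nat) (u : 'rV[R]_n * R -> R)
    (p : 'rV[R]_n * R) : R :=
  dt (dt u) p * (n%:R + laplacian_x u p) - \sum_(j < n) dx j (dt u) p ^+ 2.

(* The admissible solution of the Dirichlet problem for the Donaldson equation
   with right-hand side [eps] and boundary values [u0], [u1]. *)
Definition donaldson_solution (R : realType) (n : nat) (eps : R)
    (u0 u1 : 'rV[R]_n -> R) (u : 'rV[R]_n * R -> R) : Prop :=
  [/\ smooth_cylinder u,
      forall x t, 0 < t < 1 -> donaldson_op u (x, t) = eps,
      forall x t, 0 < t < 1 -> 0 <= n%:R + laplacian_x u (x, t),
      forall x, u (x, 0) = u0 x
    & forall x, u (x, 1) = u1 x].

(* Main.v *)
(* Write v = u + (1 - lambda)|x|^2/2, so that the claim for slightly smaller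
   lambda is the convexity of v in x and the equation reads
     v_tt (Delta v + n lambda) - |grad v_t|^2 = eps.
   If convexity fails, then for N large the gap
     v(mean x_i, t) - mean v(x_i, t) + delta t (t - 1)
   has a positive maximum over (x_1, ..., x_N, t). It is not at t = 0 or t = 1,
   by Jensen's inequality for the data. At the maximum the form Q_0 of the
   second derivatives of v at (mean x_i, t) satisfies
     Q_0(mean h_i, tau) + 2 delta tau^2 <= mean Q_i(h_i, tau)
   for all h_i and tau, and taking h_i = h, h_j = -h/(N-1) for j != i shows
   that the spatial Hessians at the points x_i are bounded below by -C/(N-1).
   After adding a small multiple of the identity one may pass to inverse
   Hessians B_i, the variables of the partial Legendre transform. For n <= 2
   the supersolution condition
     c (tr B^-1 + n lambda) - |p|^2 <= eps
   defines a convex set in terms of (B, q = B p, d = c - p.q), so the averages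
   satisfy it as well, and delta > 0 gives a contradiction. *)

Require Import Defs.
From HB Require Import structures.
From mathcomp Require Import all_boot all_order all_algebra.
From mathcomp Require Import all_classical all_reals all_analysis.
From mathcomp Require Import ring lra.
Import Order.TTheory GRing.Theory Num.Theory.
Import numFieldNormedType.Exports.
Local Open Scope classical_set_scope.
Local Open Scope ring_scope.

Set Implicit Arguments.
Unset Strict Implicit.
Unset Printing Implicit Defensive.

(** * Duality for averaged quadratic forms *)

Definition mean (R : realFieldType) (N : nat) (f : 'I_N -> R) : R :=
  N%:R^-1 * \sum_i f i.

Lemma meanD (R : realFieldType) (N : nat) (f g : 'I_N -> R) :
  mean (fun i => f i + g i) = mean f + mean g.
Proof. by rewrite /mean big_split mulrDr. Qed.

Lemma meanZ (R : realFieldType) (N : nat) (k : R) (f : 'I_N -> R) :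
  mean (fun i => k * f i) = k * mean f.
Proof. by rewrite /mean -mulr_sumr mulrCA. Qed.

Lemma mean_cst (R : realFieldType) (N : nat) (k : R) :
  (0 < N)%N -> mean (fun _ : 'I_N => k) = k.
Proof.
move=> N0; rewrite /mean sumr_const card_ord -[k *+ N]mulr_natl mulrA mulVf ?mul1r //.
by rewrite pnatr_eq0 -lt0n.
Qed.

Lemma eq_mean (R : realFieldType) (N : nat) (f g : 'I_N -> R) :
  f =1 g -> mean f = mean g.
Proof. by move=> fg; rewrite /mean; congr (_ * _); apply: eq_bigr => i _. Qed.

Lemma ler_mean (R : realFieldType) (N : nat) (f g : 'I_N -> R) :
  (forall i, f i <= g i) -> mean f <= mean g.
Proof.
by move=> fg; rewrite ler_wpM2l ?invr_ge0 ?ler0n //; apply: ler_sum.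
Qed.

Lemma mean_gt0 (R : realFieldType) (N : nat) (f : 'I_N -> R) :
  (0 < N)%N -> (forall i, 0 < f i) -> 0 < mean f.
Proof.
case: N f => // N f _ f0; rewrite mulr_gt0 ?invr_gt0 ?ltr0n //.
by rewrite big_ord_recl ltr_wpDr ?f0 // sumr_ge0 // => i _; exact: ltW.
Qed.

Definition qform2 (R : realFieldType) (a b c x y : R) : R :=
  a * x ^+ 2 + 2 * b * x * y + c * y ^+ 2.

Lemma qform2_ge0 (R : realFieldType) (a b c x y : R) :
  0 < a -> 0 < a * c - b ^+ 2 -> 0 <= qform2 a b c x y.
Proof.
move=> a0 D0; rewrite -(pmulr_rge0 _ a0) /qform2.
have -> : a * (a * x ^+ 2 + 2 * b * x * y + c * y ^+ 2) =
  (a * x + b * y) ^+ 2 + (a * c - b ^+ 2) * y ^+ 2 by ring.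
by rewrite addr_ge0 ?sqr_ge0 // mulr_ge0 ?sqr_ge0 // ltW.
Qed.

Lemma qform2_gt0P (R : realFieldType) (a b c : R) :
  (forall x y, (x, y) != (0, 0) -> 0 < qform2 a b c x y) ->
  0 < a /\ 0 < a * c - b ^+ 2.
Proof.
move=> H.
have a0 : 0 < a.
  have := H 1 0; rewrite /qform2 xpair_eqE oner_eq0 /= => /(_ isT).
  by have -> : a * 1 ^+ 2 + 2 * b * 1 * 0 + c * 0 ^+ 2 = a by ring.
split=> //; rewrite -(pmulr_rgt0 _ a0).
(* At (b, -a) the form takes the value a (a c - b^2). *)
have := H b (- a); rewrite xpair_eqE oppr_eq0 (gt_eqF a0) andbF /= => /(_ isT).
by congr (_ < _); rewrite /qform2; ring.
Qed.

(* Here [b] is the inverse of the Hessian block [A], [q = b p], and [d] is the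
   Schur complement [c - p A^-1 p]. The right-hand side is affine in
   [(b, q)], and minimizing it over [(Y, y, w)] gives the concave function that
   bounds [d] when [c (tr A + nu) - |p|^2 <= e]. *)
Lemma dual_affine_bound (R : realFieldType) (nu e b1 b2 b3 q1 q2 c Y1 Y2 Y3 y1 y2 w1 w2 : R)
    (D := b1 * b3 - b2 ^+ 2) (p1 := (b3 * q1 - b2 * q2) / D)
    (p2 := (b1 * q2 - b2 * q1) / D) :
  0 < nu -> 0 < e -> 0 < b1 -> 0 < D ->
  c * ((b1 + b3) / D + nu) - (p1 ^+ 2 + p2 ^+ 2) <= e ->
  c - (q1 * p1 + q2 * p2) <=
  e * (qform2 b1 b2 b3 Y1 Y2 + qform2 b1 b2 b3 Y2 Y3 +
       (1 - (Y1 + Y3)) ^+ 2 / nu)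
  - 2 * (y1 * q1 + y2 * q2) + qform2 b1 b2 b3 y1 y2 +
  qform2 b3 (- b2) b1 w1 w2 + ((w1 - y1) ^+ 2 + (w2 - y2) ^+ 2) / nu.
Proof.
move=> nu0 e0 b10 D0 Hc.
have b30 : 0 < b3.
  by rewrite -(pmulr_rgt0 _ b10); apply: le_lt_trans (sqr_ge0 b2) _; rewrite -subr_gt0.
have t0 : 0 < b1 + b3 by rewrite addr_gt0.
set t := b1 + b3 in t0 Hc *.
set a := t / D in Hc *.
have a0 : 0 < a by rewrite divr_gt0.
have tD : 0 < t + nu * D by rewrite addr_gt0 // mulr_gt0.
have Dn0 : D != 0 by rewrite gt_eqF.
have tDn0 : t + nu * D != 0 by rewrite gt_eqF.
have nun0 : nu != 0 by rewrite gt_eqF.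
have an0 : a != 0 by rewrite gt_eqF.
have anu : 0 < a + nu by rewrite addr_gt0.
set P := qform2 b1 b2 b3 Y1 Y2 + qform2 b1 b2 b3 Y2 Y3.
set s := Y1 + Y3.
set S := (q1 ^+ 2 + q2 ^+ 2 + nu * qform2 b3 (- b2) b1 q1 q2) / (t + nu * D).
(* Let B have entries [b1], [b2], [b3] and let Y be symmetric. Then P = tr(Y B Y), and for fixed
   trace s its least value is s^2 / a, reached at Y = (s / a) B^-1. Minimizing over s as well gives
   1 / (a + nu). *)
have T1 : 1 <= (a + nu) * (P + (1 - s) ^+ 2 / nu).
  have P0 : 0 <= P - s ^+ 2 / a.
    have -> : P - s ^+ 2 / a =
      qform2 b1 b2 b3 (Y1 - s / a * (b3 / D)) (Y2 - s / a * (- b2 / D)) +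
      qform2 b1 b2 b3 (Y2 - s / a * (- b2 / D)) (Y3 - s / a * (b1 / D)).
      have an0' : b1 + b3 != 0 by rewrite gt_eqF.
      rewrite /P /s /a /t /qform2; rewrite /D in Dn0 *; field.
      by rewrite Dn0 an0'.
    by apply: addr_ge0; exact: qform2_ge0.
  have -> : (a + nu) * (P + (1 - s) ^+ 2 / nu) =
     1 + (a + nu) * (P - s ^+ 2 / a) + (a + nu) * (a + nu) / (a * nu) * (s - a / (a + nu)) ^+ 2.
    by field; rewrite nun0 an0 gt_eqF.
  have k1 : 0 <= (a + nu) * (P - s ^+ 2 / a) by rewrite mulr_ge0 // ltW.
  have k2 : 0 <= (a + nu) * (a + nu) / (a * nu) * (s - a / (a + nu)) ^+ 2.
    apply: mulr_ge0; last exact: sqr_ge0.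
    by apply/ltW/divr_gt0; exact: mulr_gt0.
  lra.
(* [S] is the maximum of a concave quadratic in (y, w). The maximizers are y = ([z1], [z2]) and w =
   ([v1], [v2]), and completing the square at them leaves three nonnegative terms. *)
have S1 : 2 * (y1 * q1 + y2 * q2) - qform2 b1 b2 b3 y1 y2
   - qform2 b3 (- b2) b1 w1 w2 - ((w1 - y1) ^+ 2 + (w2 - y2) ^+ 2) / nu <= S.
  rewrite -subr_ge0.
  pose k := t + nu * D.
  pose z1 := (q1 + nu * (b3 * q1 - b2 * q2)) / k.
  pose z2 := (q2 + nu * (b1 * q2 - b2 * q1)) / k.
  pose v1 := q1 / k; pose v2 := q2 / k.
  rewrite [X in 0 <= X](_ : _ = qform2 b1 b2 b3 (y1 - z1) (y2 - z2) +
     qform2 b3 (- b2) b1 (w1 - v1) (w2 - v2) +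
     (((w1 - v1) - (y1 - z1)) ^+ 2 + ((w2 - v2) - (y2 - z2)) ^+ 2) / nu); last first.
    rewrite /S /z1 /z2 /v1 /v2 /k /qform2; rewrite /t /D in tDn0 *; field.
    by rewrite nun0.
  have D0' : 0 < b3 * b1 - (- b2) ^+ 2 by rewrite sqrrN mulrC.
  apply: addr_ge0; first by apply: addr_ge0; exact: qform2_ge0.
  by rewrite divr_ge0 ?addr_ge0 ?sqr_ge0 // ltW.
have c1 : c <= (e + (p1 ^+ 2 + p2 ^+ 2)) / (a + nu).
  by rewrite ler_pdivlMr //; lra.
(* With this form of [S], the bound [c1] reads c - q.p <= e / (a + nu) - S. *)
have Seq : S = q1 * p1 + q2 * p2 - (p1 ^+ 2 + p2 ^+ 2) / (a + nu).
  rewrite /S /p1 /p2 /a /t /D /qform2; rewrite /t /D in Dn0 tDn0; field.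
  by rewrite tDn0 Dn0.
have T2 : e / (a + nu) <= e * (P + (1 - s) ^+ 2 / nu).
  by rewrite ler_pM2l // -[_^-1]mul1r ler_pdivrMr // mulrC.
rewrite mulrDl in c1; lra.
Qed.

Lemma qform2_gt0 (R : realFieldType) (a b c x y : R) :
  0 < a -> 0 < a * c - b ^+ 2 -> (x, y) != (0, 0) -> 0 < qform2 a b c x y.
Proof.
move=> a0 D0 xy; rewrite -(pmulr_rgt0 _ a0) /qform2.
have -> : a * (a * x ^+ 2 + 2 * b * x * y + c * y ^+ 2) =
  (a * x + b * y) ^+ 2 + (a * c - b ^+ 2) * y ^+ 2 by ring.
have [y0|y0] := eqVneq y 0.
  rewrite y0 xpair_eqE eqxx andbT in xy *.
  have -> : (a * x + b * 0) ^+ 2 + (a * c - b ^+ 2) * 0 ^+ 2 = (a * x) ^+ 2 by ring.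
  by rewrite lt0r sqr_ge0 sqrf_eq0 mulf_neq0 // gt_eqF.
apply: ltr_wpDl; first exact: sqr_ge0.
by apply: mulr_gt0 => //; rewrite lt0r sqr_ge0 sqrf_eq0 y0.
Qed.

(** Averages expressions affine in the five entries of (B_i, q_i); the Schur complement s_i can take
    one of the slots. *)
Lemma mean_affine5 (R : realFieldType) (N : nat) (f1 f2 f3 f4 f5 : 'I_N -> R)
    (k0 k1 k2 k3 k4 k5 : R) : (0 < N)%N ->
  mean (fun i => k0 + (k1 * f1 i + (k2 * f2 i + (k3 * f3 i + (k4 * f4 i + k5 * f5 i))))) =
  k0 + (k1 * mean f1 + (k2 * mean f2 + (k3 * mean f3 + (k4 * mean f4 + k5 * mean f5)))).
Proof. by move=> N0; rewrite !meanD mean_cst // !meanZ. Qed.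

Definition qform3 (R : realFieldType) (a b c p1 p2 d x y t : R) : R :=
  qform2 a b c x y + 2 * t * (p1 * x + p2 * y) + d * t ^+ 2.

(** In the dual variables each condition becomes a family of inequalities affine in (B_i, q_i), so
    it survives averaging. The hypothesis on the forms bounds the form at the mean by the one
    rebuilt from the averaged dual data, and the supersolution condition passes down to the smaller
    form. *)
Lemma mean_supersolution (R : realFieldType) (N : nat) (nu e : R)
    (a b c p1 p2 d : 'I_N -> R) (A1 A2 A3 P1 P2 C : R) :
  (0 < N)%N -> 0 < nu -> 0 < e -> 0 < C ->
  (forall i, 0 < a i) -> (forall i, 0 < a i * c i - b i ^+ 2) ->
  (forall i, d i * (a i + c i + nu) - (p1 i ^+ 2 + p2 i ^+ 2) <= e) ->
  (forall (h k : 'I_N -> R) t,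
    qform3 A1 A2 A3 P1 P2 C (mean h) (mean k) t <=
    mean (fun i => qform3 (a i) (b i) (c i) (p1 i) (p2 i) (d i) (h i) (k i) t)) ->
  C * (A1 + A3 + nu) - (P1 ^+ 2 + P2 ^+ 2) <= e.
Proof.
move=> N0 nu0 e0 C0 a0 D0 He HQ.
pose D i := a i * c i - b i ^+ 2.
have Dn0 i : D i != 0 by rewrite gt_eqF // D0.
pose b1 i := c i / D i; pose b2 i := - b i / D i; pose b3 i := a i / D i.
have c0 i : 0 < c i.
  by rewrite -(pmulr_rgt0 _ (a0 i)); apply: le_lt_trans (sqr_ge0 (b i)) _; rewrite -subr_gt0.
have b10 i : 0 < b1 i by rewrite divr_gt0 // D0.
have DB i : b1 i * b3 i - b2 i ^+ 2 = (D i)^-1.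
  by rewrite /b1 /b2 /b3; move: (Dn0 i); rewrite /D => H; field.
have DB0 i : 0 < b1 i * b3 i - b2 i ^+ 2 by rewrite DB invr_gt0 D0.
pose q1 i := b1 i * p1 i + b2 i * p2 i; pose q2 i := b2 i * p1 i + b3 i * p2 i.
pose s i := d i - (q1 i * p1 i + q2 i * p2 i).
have p1E i : (b3 i * q1 i - b2 i * q2 i) / (b1 i * b3 i - b2 i ^+ 2) = p1 i.
  by rewrite /q1 /q2; field; rewrite gt_eqF.
have p2E i : (b1 i * q2 i - b2 i * q1 i) / (b1 i * b3 i - b2 i ^+ 2) = p2 i.
  by rewrite /q1 /q2; field; rewrite gt_eqF.
pose B1 := mean b1; pose B2 := mean b2; pose B3 := mean b3.
pose Q1 := mean q1; pose Q2 := mean q2; pose S := mean s.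
have [B10 DBm] : 0 < B1 /\ 0 < B1 * B3 - B2 ^+ 2.
  apply: qform2_gt0P => x y xy.
  have -> : qform2 B1 B2 B3 x y = mean (fun i => qform2 (b1 i) (b2 i) (b3 i) x y).
    rewrite (@eq_mean _ _ _ (fun i => 0 + (x ^+ 2 * b1 i + (2 * x * y * b2 i +
      (y ^+ 2 * b3 i + (0 * b1 i + 0 * b1 i)))))); last by move=> i; rewrite /qform2; ring.
    by rewrite mean_affine5 // /qform2 /B1 /B2 /B3; ring.
  by apply: mean_gt0 => // i; apply: qform2_gt0.
set DBM := B1 * B3 - B2 ^+ 2 in DBm.
have DBMn0 : DBM != 0 by rewrite gt_eqF.
have B30 : 0 < B3.
  by rewrite -(pmulr_rgt0 _ B10); apply: le_lt_trans (sqr_ge0 B2) _; rewrite -subr_gt0.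
have dual Y1 Y2 Y3 y1 y2 w1 w2 : S <=
  e * (qform2 B1 B2 B3 Y1 Y2 + qform2 B1 B2 B3 Y2 Y3 + (1 - (Y1 + Y3)) ^+ 2 / nu)
  - 2 * (y1 * Q1 + y2 * Q2) + qform2 B1 B2 B3 y1 y2 +
  qform2 B3 (- B2) B1 w1 w2 + ((w1 - y1) ^+ 2 + (w2 - y2) ^+ 2) / nu.
  pose rhs i := e * (qform2 (b1 i) (b2 i) (b3 i) Y1 Y2 + qform2 (b1 i) (b2 i) (b3 i) Y2 Y3
    + (1 - (Y1 + Y3)) ^+ 2 / nu)
    - 2 * (y1 * q1 i + y2 * q2 i) + qform2 (b1 i) (b2 i) (b3 i) y1 y2 +
    qform2 (b3 i) (- b2 i) (b1 i) w1 w2 + ((w1 - y1) ^+ 2 + (w2 - y2) ^+ 2) / nu.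
  have -> : e * (qform2 B1 B2 B3 Y1 Y2 + qform2 B1 B2 B3 Y2 Y3 + (1 - (Y1 + Y3)) ^+ 2 / nu)
     - 2 * (y1 * Q1 + y2 * Q2) + qform2 B1 B2 B3 y1 y2 +
     qform2 B3 (- B2) B1 w1 w2 + ((w1 - y1) ^+ 2 + (w2 - y2) ^+ 2) / nu = mean rhs.
    rewrite (@eq_mean _ _ rhs (fun i =>
      (e * ((1 - (Y1 + Y3)) ^+ 2 / nu) + ((w1 - y1) ^+ 2 + (w2 - y2) ^+ 2) / nu) +
      ((e * (Y1 ^+ 2 + Y2 ^+ 2) + y1 ^+ 2 + w2 ^+ 2) * b1 i +
      ((e * (2 * Y1 * Y2 + 2 * Y2 * Y3) + 2 * y1 * y2 - 2 * w1 * w2) * b2 i +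
      ((e * (Y2 ^+ 2 + Y3 ^+ 2) + y2 ^+ 2 + w1 ^+ 2) * b3 i +
      ((- 2 * y1) * q1 i + (- 2 * y2) * q2 i)))))); last first.
      by move=> i; rewrite /rhs /qform2; ring.
    by rewrite mean_affine5 // /qform2 /B1 /B2 /B3 /Q1 /Q2; ring.
  apply: ler_mean => i; rewrite /rhs /s -{1}(p1E i) -{1}(p2E i).
  apply: dual_affine_bound => //.
  rewrite p1E p2E.
  have -> : (b1 i + b3 i) / (b1 i * b3 i - b2 i ^+ 2) = a i + c i.
    by rewrite DB invrK /b1 /b3; field.
  exact: He.
(* The duality is undone for the averages: [ae] is the trace of the inverse of the mean of the B_i,
   ([R1], [R2]) the mixed entries, [ce] the time entry. *)
pose ae := (B1 + B3) / DBM.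
have ae0 : 0 < ae by rewrite divr_gt0 // addr_gt0.
have aenu : 0 < ae + nu by rewrite addr_gt0.
pose R1 := (B3 * Q1 - B2 * Q2) / DBM; pose R2 := (B1 * Q2 - B2 * Q1) / DBM.
pose ce := Q1 * R1 + Q2 * R2 + S.
have ceP : ce * (ae + nu) <= e + (R1 ^+ 2 + R2 ^+ 2).
  rewrite -ler_pdivlMr //.
  have tD : 0 < B1 + B3 + nu * DBM by rewrite !addr_gt0 // mulr_gt0.
  have tDn0 : B1 + B3 + nu * DBM != 0 by rewrite gt_eqF.
  have nun0 : nu != 0 by rewrite gt_eqF.
  pose k := B1 + B3 + nu * DBM.
  (* The minimizers of the dual right-hand side, with the averaged matrix: Y = B^-1 / (ae + nu), and
     y, w as in the completed square of [dual_affine_bound]. *)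
  have := dual (B3 / k) (- B2 / k) (B1 / k)
     ((Q1 + nu * (B3 * Q1 - B2 * Q2)) / k) ((Q2 + nu * (B1 * Q2 - B2 * Q1)) / k)
     (Q1 / k) (Q2 / k).
  rewrite -lerBrDl; congr (_ <= _).
  rewrite /k /ae /R1 /R2 /DBM /qform2; rewrite /DBM in DBMn0 tDn0; field.
  by rewrite nun0 DBMn0 tDn0.
(* Take h_i = B_i (xi - t p_i) with xi = (x, y). Its mean is B xi - t Q, and the i-th form equals
   xi.B_i xi + s_i t^2, so both sides depend only on averages. *)
have HB x y t : qform3 A1 A2 A3 P1 P2 C (B1 * x + B2 * y - Q1 * t)
    (B2 * x + B3 * y - Q2 * t) t <= qform2 B1 B2 B3 x y + S * t ^+ 2.
  have := HQ (fun i => b1 i * (x - p1 i * t) + b2 i * (y - p2 i * t))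
    (fun i => b2 i * (x - p1 i * t) + b3 i * (y - p2 i * t)) t.
  congr (_ <= _); first congr qform3.
  - rewrite (@eq_mean _ _ _ (fun i => 0 + (x * b1 i + (y * b2 i + (0 * b3 i +
      (- t * q1 i + 0 * q2 i)))))); last by move=> i; rewrite /q1; ring.
    by rewrite mean_affine5 // /B1 /B2 /Q1; ring.
  - rewrite (@eq_mean _ _ _ (fun i => 0 + (0 * b1 i + (x * b2 i + (y * b3 i +
      (0 * q1 i + - t * q2 i)))))); last by move=> i; rewrite /q2; ring.
    by rewrite mean_affine5 // /B3 /B2 /Q2; ring.
  rewrite (@eq_mean _ _ _ (fun i => 0 + (x ^+ 2 * b1 i + (2 * x * y * b2 i + (y ^+ 2 * b3 i +
      (0 * q1 i + t ^+ 2 * s i)))))); last first.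
    move=> i; rewrite /s /q1 /q2 /b1 /b2 /b3 /qform3 /qform2.
    by move: (Dn0 i); rewrite /D => H; field.
  by rewrite mean_affine5 // /B1 /B2 /B3 /qform2 /S; ring.
(* Solve B xi - t Q = (h, k) for xi. *)
have HE h k t : qform3 A1 A2 A3 P1 P2 C h k t <=
  qform3 (B3 / DBM) (- B2 / DBM) (B1 / DBM) R1 R2 ce h k t.
  have := HB ((B3 * (h + Q1 * t) - B2 * (k + Q2 * t)) / DBM)
             ((B1 * (k + Q2 * t) - B2 * (h + Q1 * t)) / DBM) t.
  congr (_ <= _).
    by congr qform3; rewrite /DBM; rewrite /DBM in DBMn0; field.
  rewrite /qform3 /qform2 /ce /R1 /R2 /DBM; rewrite /DBM in DBMn0; field.
  by [].
have Cce : C <= ce.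
  by have := HE 0 0 1; rewrite /qform3 /qform2; lra.
have ce0 : 0 < ce by exact: lt_le_trans Cce.
(* The time components minimize the larger form in t over the two unit vectors. *)
have F1 := HE 1 0 (- R1 / ce).
have F2 := HE 0 1 (- R2 / ce).
(* The sum of the two tests compares the traces of the spatial Schur complements. The squares with
   factor C appear because the chosen times need not minimize the smaller form. *)
have F3 : A1 + A3 + nu - (P1 ^+ 2 + P2 ^+ 2) / C <= ae + nu - (R1 ^+ 2 + R2 ^+ 2) / ce.
  have k1 : 0 <= C * (R1 / ce - P1 / C) ^+ 2 by rewrite mulr_ge0 ?sqr_ge0 // ltW.
  have k2 : 0 <= C * (R2 / ce - P2 / C) ^+ 2 by rewrite mulr_ge0 ?sqr_ge0 // ltW.
  rewrite -subr_ge0.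
  have : 0 <= (qform3 (B3 / DBM) (- B2 / DBM) (B1 / DBM) R1 R2 ce 1 0 (- R1 / ce) -
     qform3 A1 A2 A3 P1 P2 C 1 0 (- R1 / ce)) +
     (qform3 (B3 / DBM) (- B2 / DBM) (B1 / DBM) R1 R2 ce 0 1 (- R2 / ce) -
     qform3 A1 A2 A3 P1 P2 C 0 1 (- R2 / ce)) + C * (R1 / ce - P1 / C) ^+ 2 +
     C * (R2 / ce - P2 / C) ^+ 2.
    by apply: addr_ge0 => //; apply: addr_ge0 => //; apply: addr_ge0; rewrite subr_ge0.
  congr (0 <= _); rewrite /qform3 /qform2 /ae; field.
  by rewrite DBMn0 !gt_eqF.
have F4 : A1 + A3 + nu - (P1 ^+ 2 + P2 ^+ 2) / C <= e / ce.
  apply: le_trans F3 _; rewrite ler_pdivlMr // mulrBl divfK ?gt_eqF //.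
  by rewrite mulrC; lra.
have F5 : e / ce <= e / C by rewrite ler_pM2l // lef_pV2 ?posrE.
have := le_trans F4 F5; rewrite ler_pdivlMr // mulrBl divfK ?gt_eqF //.
by rewrite mulrC.
Qed.

(** Two sizes compete. Having K < eta (N - 1) makes every spatial block positive definite once eta
    times the identity is added, and eta K^2 < dl eps makes the error of this shift smaller than the
    gain from the strict term 2 dl t^2. *)
Lemma no_strict_touching (R : realFieldType) (N : nat) (nu eps dl K eta : R)
    (a b c p1 p2 d : 'I_N -> R) (A1 A2 A3 P1 P2 C : R) :
  (1 < N)%N -> 0 < nu -> 0 < eps -> 0 < dl -> 0 < eta ->
  K < eta * N.-1%:R -> eta * K ^+ 2 < dl * eps ->
  (forall i, d i * (a i + c i + nu) - (p1 i ^+ 2 + p2 i ^+ 2) = eps) ->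
  (forall i, d i <= K) ->
  (forall i x y, qform2 (a i) (b i) (c i) x y <= K * (x ^+ 2 + y ^+ 2)) ->
  C * (A1 + A3 + nu) - (P1 ^+ 2 + P2 ^+ 2) = eps -> 0 < C <= K ->
  (forall (h k : 'I_N -> R) t,
    qform3 A1 A2 A3 P1 P2 C (mean h) (mean k) t + 2 * dl * t ^+ 2 <=
    mean (fun i => qform3 (a i) (b i) (c i) (p1 i) (p2 i) (d i) (h i) (k i) t)) ->
  False.
Proof.
move=> N1 nu0 eps0 dl0 eta0 Keta etaK Hd dK qK HC /andP[C0 CK] HQ.
have K0 : 0 < K := lt_le_trans C0 CK.
have N0 : (0 < N)%N by apply: ltnW.
have M0 : 0 < N.-1%:R :> R by rewrite ltr0n -subn1 subn_gt0.
have apos i : 0 < a i + eta /\ 0 < (a i + eta) * (c i + eta) - b i ^+ 2.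
  apply: qform2_gt0P => x y xy.
  have r0 : 0 < x ^+ 2 + y ^+ 2.
    have := @qform2_gt0 R 1 0 1 x y ltr01; rewrite /qform2 => /(_ _ xy).
    by rewrite expr0n /= mulr1 subr0 ltr01 => /(_ isT); congr (_ < _); ring.
  pose m := N.-1%:R^-1 : R.
  have m0 : 0 < m by rewrite invr_gt0.
  (* A test vector with mean zero, so that the left side of [HQ] vanishes: the entry x at i is
     balanced by -x / (N - 1) at every other index. *)
  pose w x (j : 'I_N) := if j == i then x else - (m * x) : R.
  have w0 z : mean (w z) = 0.
    rewrite /mean (bigD1 i) //= {1}/w eqxx (eq_bigr (fun=> - (m * z))); last first.
      by move=> j /negbTE ji; rewrite /w ji.
    rewrite sumr_const cardC1 card_ord.
    have -> : - (m * z) *+ N.-1 = - z.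
      by rewrite -mulr_natl mulrN mulrA divff ?gt_eqF // mul1r.
    by rewrite subrr mulr0.
  have := HQ (w x) (w y) 0; rewrite !w0 /qform3 /qform2.
  have -> : A1 * 0 ^+ 2 + 2 * A2 * 0 * 0 + A3 * 0 ^+ 2 + 2 * 0 * (P1 * 0 + P2 * 0)
     + C * 0 ^+ 2 + 2 * dl * 0 ^+ 2 = 0 by ring.
  rewrite (@eq_mean _ _ _ (fun j => qform2 (a j) (b j) (c j) (w x j) (w y j))); last first.
    by move=> j; rewrite /qform2; ring.
  rewrite /mean pmulr_rge0 ?invr_gt0 ?ltr0n // (bigD1 i) //= /w eqxx => H.
  have S1 : \sum_(j < N | j != i) qform2 (a j) (b j) (c j)
      (if j == i then x else - (m * x)) (if j == i then y else - (m * y))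
      <= m * (K * (x ^+ 2 + y ^+ 2)).
    apply: (@le_trans _ _ (\sum_(j < N | j != i) m ^+ 2 * (K * (x ^+ 2 + y ^+ 2)))).
      apply: ler_sum => j /negbTE ->.
      rewrite [X in X <= _](_ : _ = m ^+ 2 * qform2 (a j) (b j) (c j) x y); last first.
        by rewrite /qform2; ring.
      by rewrite ler_wpM2l ?sqr_ge0.
    rewrite sumr_const cardC1 card_ord -mulr_natl.
    by rewrite expr2 -[m * m * _]mulrA [X in X <= _]mulrA divff ?gt_eqF // mul1r.
  have S2 : m * (K * (x ^+ 2 + y ^+ 2)) < eta * (x ^+ 2 + y ^+ 2).
    by rewrite mulrA ltr_pM2r // mulrC ltr_pdivrMr.
  have H2 := le_trans H (lerD (lexx _) S1).
  rewrite /qform2 in H2 *; lra.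
(* Shifting both diagonal entries by eta raises the operator by 2 eta d_i, which is at most 2 eta
   K. *)
pose e := eps + 2 * eta * K.
have e0 : 0 < e by rewrite addr_gt0 // !mulr_gt0.
have trpos : eps <= K * (A1 + A3 + nu).
  have tr0 : 0 <= A1 + A3 + nu.
    rewrite -(pmulr_rge0 _ C0).
    by have := sqr_ge0 P1; have := sqr_ge0 P2; lra.
  apply: (@le_trans _ _ (C * (A1 + A3 + nu))); last by rewrite ler_wpM2r.
  by have := sqr_ge0 P1; have := sqr_ge0 P2; lra.
(* The form at the mean solves the equation exactly with time entry C. Raising this entry by 2 dl
   therefore forces 2 dl (A1 + A3 + nu) <= 2 eta K, against [trpos]. *)
have : (C + 2 * dl) * (A1 + A3 + nu) - (P1 ^+ 2 + P2 ^+ 2) <= e.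
  apply: (@mean_supersolution _ N nu e (fun i => a i + eta) b (fun i => c i + eta)
     p1 p2 d _ A2) => //.
  - by apply: addr_gt0 => //; apply: mulr_gt0.
  - by move=> i; case: (apos i).
  - by move=> i; case: (apos i).
  - move=> i; rewrite /e -(Hd i).
    have : eta * d i <= eta * K by rewrite ler_wpM2l // ltW.
    by lra.
  - move=> h k t; have := HQ h k t; rewrite /qform3 => HQ'.
    have -> : qform2 A1 A2 A3 (mean h) (mean k) + 2 * t * (P1 * mean h + P2 * mean k) +
       (C + 2 * dl) * t ^+ 2 = qform2 A1 A2 A3 (mean h) (mean k) +
       2 * t * (P1 * mean h + P2 * mean k) + C * t ^+ 2 + 2 * dl * t ^+ 2 by ring.
    apply: le_trans HQ' _; apply: ler_mean => i; rewrite !lerD2r /qform2.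
    have := mulr_ge0 (ltW eta0) (sqr_ge0 (h i)).
    by have := mulr_ge0 (ltW eta0) (sqr_ge0 (k i)); lra.
rewrite /e => H.
have H2 : dl * (A1 + A3 + nu) <= eta * K by lra.
have H3 : dl * eps <= eta * K ^+ 2.
  apply: (@le_trans _ _ (dl * (K * (A1 + A3 + nu)))); first by rewrite ler_wpM2l // ltW.
  have -> : eta * K ^+ 2 = K * (eta * K) by ring.
  by rewrite mulrCA ler_wpM2l // ltW.
by move: H3; rewrite leNgt etaK.
Qed.

(** * Second derivatives along lines *)

Lemma is_derive_line (R : realType) (V : normedModType R) (f : V -> R)
    (x v : V) (s : R) :
  derivable f (x + s *: v) v ->
  is_derive s 1 (fun s : R => f (x + s *: v)) ('D_v f (x + s *: v)).
Proof.
move=> df.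
have E : (fun h : R => h^-1 *: (((fun s : R => f (x + s *: v)) \o shift s) (h *: 1) -
     f (x + s *: v))) =
  (fun h : R => h^-1 *: ((f \o shift (x + s *: v)) (h *: v) - f (x + s *: v))).
  apply/funext => h /=; congr (_ *: (f _ - _)).
  by rewrite (_ : h *: 1 = h) ?scalerDl 1?addrCA //; exact: mulr1.
by apply: DeriveDef; [rewrite /derivable E | rewrite /derive E].
Qed.

Lemma MVT_line (R : realType) (V : normedModType R) (f : V -> R) (x v : V) (h : R) :
  0 < h -> (forall s, 0 <= s <= h -> derivable f (x + s *: v) v) ->
  exists2 s, 0 <= s <= h & f (x + h *: v) - f x = h * 'D_v f (x + s *: v).
Proof.
move=> h0 df.
have dl s : 0 <= s <= h ->
    is_derive s 1 (fun s : R => f (x + s *: v)) ('D_v f (x + s *: v)).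
  by move=> /df; exact: is_derive_line.
have ds s : s \in `]0, h[%R ->
    is_derive s 1 (fun s : R => f (x + s *: v)) ('D_v f (x + s *: v)).
  by rewrite in_itv /= => /andP[s0 sh]; apply: dl; rewrite !ltW.
have cs : {within `[0, h], continuous (fun s : R => f (x + s *: v))}.
  apply: derivable_within_continuous => s; rewrite in_itv /= => /dl dls.
  by apply: ex_derive; exact: dls.
have [s] := MVT_segment (ltW h0) ds cs.
rewrite in_itv /= => sh; rewrite scale0r addr0 subr0 => E.
by exists s => //; rewrite E mulrC.
Qed.

Lemma near_parallelogram (R : realType) (V : normedModType R) (P : set V) (x v w : V) :
  (\forall y \near x, P y) ->
  exists2 r : R, 0 < r &
    forall a b, 0 <= a <= r -> 0 <= b <= r -> P (x + a *: v + b *: w).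
Proof.
move=> /nbhs_ballP[d /= d0 dP].
have S0 : 0 < `|v| + `|w| + 1 by rewrite ltr_wpDl // addr_ge0.
exists (d / (`|v| + `|w| + 1)); first by rewrite divr_gt0.
set r := d / _; have r0 : 0 < r by rewrite divr_gt0.
move=> a b /andP[a0 ar] /andP[b0 br]; apply: dP.
rewrite -ball_normE /= -addrA opprD addNKr.
rewrite normrN (le_lt_trans (ler_normD _ _)) // !normrZ !ger0_norm //.
have -> : d = r * (`|v| + `|w| + 1) by rewrite /r divfK // gt_eqF.
rewrite !mulrDr mulr1.
have := ler_wpM2r (normr_ge0 v) ar; have := ler_wpM2r (normr_ge0 w) br; lra.
Qed.

Lemma near_eq0P (R : realType) (x : R) : (forall e, 0 < e -> `|x| <= e) -> x = 0.
Proof.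
move=> H; apply/eqP; rewrite -normr_le0; apply/ler_addgt0Pl => e e0.
by rewrite addr0 H.
Qed.

Lemma continuous_parallelogram (R : realType) (V : normedModType R) (g : V -> R)
    (x v w : V) (e : R) :
  {for x, continuous g} -> 0 < e ->
  exists2 r : R, 0 < r & forall a b, 0 <= a <= r -> 0 <= b <= r ->
    `|g (x + a *: v + b *: w) - g x| <= e.
Proof.
move=> cg e0.
apply: (@near_parallelogram _ _ (fun y => `|g y - g x| <= e)).
have /cvgrPdist_le/(_ e e0) := cg.
by apply: filterS => y; rewrite distrC.
Qed.

Lemma norm_le_limit3 (R : realType) (a b c a' b' c' e : R) :
  a' = b' + c' -> `|a' - a| <= e / 3 -> `|b' - b| <= e / 3 -> `|c' - c| <= e / 3 ->
  `|a - (b + c)| <= e.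
Proof.
move=> ->; rewrite !ler_norml => /andP[? ?] /andP[? ?] /andP[? ?].
by apply/andP; split; lra.
Qed.

Lemma norm_le_limit2 (R : realType) (a b a' b' e : R) :
  a' = b' -> `|a' - a| <= e / 2 -> `|b' - b| <= e / 2 -> `|a - b| <= e.
Proof.
move=> ->; rewrite !ler_norml => /andP[? ?] /andP[? ?].
by apply/andP; split; lra.
Qed.

Lemma subrACA (R : zmodType) (a b c d : R) : a - b - (c - d) = a - c - (b - d).
Proof. by rewrite !opprB addrACA addrAC -!addrA; congr (_ + _); rewrite addrCA [- b + _]addrC. Qed.

(** [Ck] speaks of directional derivatives only, so additivity in the direction is derived from
    continuity. The increment along h (v + w) is the sum of those along h v and then h w; the mean
    value theorem turns each into a derivative at a point near x, and h is taken small. *)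
Lemma derive_dirD (R : realType) (V : normedModType R) (U : set V) (f : V -> R)
    (x v w : V) :
  open U -> U x -> Ck 1 U f -> 'D_(v + w) f x = 'D_v f x + 'D_w f x.
Proof.
move=> oU Ux [_ Cf].
have df u y : U y -> derivable f y u by move=> Uy; apply: (Cf u).1.
have cf u : {for x, continuous ('D_u f)} by apply: (Cf u).2.1.
have NU : \forall y \near x, U y by exact: open_nbhs_nbhs.
apply/eqP; rewrite -subr_eq0; apply/eqP; apply: near_eq0P => e e0.
have e30 : 0 < e / 3 by rewrite divr_gt0.
have [r0 r00 H0] := @near_parallelogram _ _ _ x v w NU.
have [r1 r10 H1] := continuous_parallelogram v w (cf (v + w)) e30.
have [r2 r20 H2] := continuous_parallelogram v w (cf w) e30.
have [r3 r30 H3] := continuous_parallelogram v w (cf v) e30.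
pose h := Num.min r0 (Num.min r1 (Num.min r2 r3)).
have h0 : 0 < h by rewrite !lt_min r00 r10 r20 r30.
have [hr0 hr1 hr2 hr3] : [/\ h <= r0, h <= r1, h <= r2 & h <= r3].
  by split; rewrite /h !ge_min lexx ?orbT.
have B s r : 0 <= s <= h -> h <= r -> 0 <= s <= r.
  by move=> /andP[-> /= /le_trans]; apply.
have hh : 0 <= h <= h by rewrite lexx ltW.
have zh : 0 <= (0 : R) <= h by rewrite lexx ltW.
have vw s : x + s *: (v + w) = x + s *: v + s *: w by rewrite scalerDr addrA.
have [s1 s1h E1] : exists2 s, 0 <= s <= h &
    f (x + h *: (v + w)) - f x = h * 'D_(v + w) f (x + s *: (v + w)).
  by apply: MVT_line => // s sh; apply: df; rewrite vw; apply: H0; exact: B.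
have [s2 s2h E2] : exists2 s, 0 <= s <= h &
    f (x + h *: v + h *: w) - f (x + h *: v) = h * 'D_w f (x + h *: v + s *: w).
  by apply: MVT_line => // s sh; apply: df; apply: H0; exact: B.
have [s3 s3h E3] : exists2 s, 0 <= s <= h &
    f (x + h *: v) - f x = h * 'D_v f (x + s *: v + 0 *: w).
  have [s sh E] : exists2 s, 0 <= s <= h &
     f (x + h *: v) - f x = h * 'D_v f (x + s *: v).
    apply: MVT_line => // s sh; apply: df; rewrite -[x + _]addr0 -(scale0r w).
    by apply: H0; [exact: B | exact: B].
  by exists s => //; rewrite scale0r addr0.
have E : 'D_(v + w) f (x + s1 *: v + s1 *: w) =
  'D_v f (x + s3 *: v + 0 *: w) + 'D_w f (x + h *: v + s2 *: w).
  apply: (@mulfI _ h); first by rewrite gt_eqF.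
  by rewrite mulrDr -E2 -E3 -vw -E1 vw [RHS]addrC addrA subrK.
have I1 := H1 s1 s1 (B _ _ s1h hr1) (B _ _ s1h hr1).
have I2 := H2 h s2 (B _ _ hh hr2) (B _ _ s2h hr2).
have I3 := H3 s3 0 (B _ _ s3h hr3) (B _ _ zh hr3).
exact: (norm_le_limit3 E I1 I3 I2).
Qed.

Lemma is_derive_mulr0 (R : realType) (k x : R) :
  is_derive x 1 (fun s : R => k * s) k.
Proof.
have := is_deriveZ k (is_derive_id x (1 : R)).
by rewrite [k *: (1 : R)]mulr1.
Qed.

Lemma derive_dirZ (R : realType) (V : normedModType R) (f : V -> R)
    (x v : V) (k : R) :
  derivable f x v -> 'D_(k *: v) f x = k * 'D_v f x.
Proof.
move=> df.
have x0 : x + (k * 0) *: v = x by rewrite mulr0 scale0r addr0.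
have dg : is_derive (k * 0) 1 (fun s : R => f (x + s *: v)) ('D_v f x).
  rewrite -{2}x0; apply: is_derive_line; rewrite x0; exact: df.
have dc := @is_derive1_comp R (fun s : R => f (x + s *: v)) (fun s => k * s) 0 _ _ dg (is_derive_mulr0 k 0).
have E : (fun s : R => f (x + s *: (k *: v))) = (fun s : R => f (x + s *: v)) \o (fun s => k * s).
  by apply/funext => s /=; rewrite scalerA mulrC.
rewrite -E in dc.
have dfk : derivable f x (k *: v).
  apply/derivable1P.
  have := @ex_derive _ _ _ _ _ _ _ dc.
  rewrite (_ : (fun s : R => f (x + s *: (k *: v))) = (fun h : R => f (h *: (k *: v) + x))) //.
  by apply/funext => s; rewrite addrC.
have := @is_derive_line _ _ f x (k *: v) 0.
rewrite !scale0r !addr0 => /(_ dfk) dl.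
rewrite -(@derive_val _ _ _ _ _ _ _ dl).
rewrite (@derive_val _ _ _ _ _ _ _ dc).
by rewrite mulrC.
Qed.
(** Schwarz's theorem: the second difference over a small parallelogram is symmetric in its two
    sides, while its two evaluations approach the two mixed derivatives. *)
Lemma derive_dirC (R : realType) (V : normedModType R) (U : set V) (f : V -> R)
    (x v w : V) :
  open U -> U x -> Ck 2 U f -> 'D_w ('D_v f) x = 'D_v ('D_w f) x.
Proof.
move=> oU Ux [_ Cf].
have NU : \forall y \near x, U y by exact: open_nbhs_nbhs.
(* The second difference of [f] over the parallelogram spanned by [h a] and
   [h b], computed by two applications of the mean value theorem. *)
have diff2 a b r : 0 < r ->
    (forall s t, 0 <= s <= r -> 0 <= t <= r -> U (x + s *: a + t *: b)) ->
    exists s t, [/\ 0 <= s <= r, 0 <= t <= r &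
      f (x + r *: a + r *: b) - f (x + r *: a) - (f (x + r *: b) - f x) =
      r ^+ 2 * 'D_b ('D_a f) (x + s *: a + t *: b)].
  move=> r0 HU.
  have rr : 0 <= r <= r by rewrite lexx ltW.
  have zr : 0 <= (0 : R) <= r by rewrite lexx ltW.
  have da s t : 0 <= s <= r -> 0 <= t <= r -> derivable f (x + s *: a + t *: b) a.
    by move=> sr tr; apply: (Cf a).1; exact: HU.
  pose g y := f (y + r *: b) - f y.
  have sh (c : V) y : derivable f (y + c) a ->
      is_derive y a (fun y => f (y + c)) ('D_a f (y + c)).
    move=> dfc; have E : (fun h : R => h^-1 *: (((fun y => f (y + c)) \o shift y) (h *: a) -
       f (y + c))) = (fun h : R => h^-1 *: ((f \o shift (y + c)) (h *: a) - f (y + c))).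
      by apply/funext => h /=; rewrite addrA.
    by apply: DeriveDef; [rewrite /derivable E | rewrite /derive E].
  have dg s : 0 <= s <= r ->
    is_derive (x + s *: a) a g ('D_a f (x + s *: a + r *: b) - 'D_a f (x + s *: a)).
    move=> sr; apply: is_deriveB; first by apply: sh; exact: da.
    by apply: derivableP; have := da s 0 sr zr; rewrite scale0r addr0.
  have [s sr Es] : exists2 s, 0 <= s <= r & g (x + r *: a) - g x = r * 'D_a g (x + s *: a).
    by apply: MVT_line => // s sr; apply: ex_derive; exact: dg.
  have [t tr Et] : exists2 t, 0 <= t <= r &
     'D_a f (x + s *: a + r *: b) - 'D_a f (x + s *: a) =
      r * 'D_b ('D_a f) (x + s *: a + t *: b).
    by apply: (@MVT_line _ _ ('D_a f)) => // t tr; have [+ _] := (Cf a).2.2 b; apply; exact: HU.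
  exists s, t; split => //.
  have dgs := dg s sr.
  rewrite (@derive_val _ _ _ _ _ _ _ dgs) Et in Es.
  by rewrite expr2 -mulrA -Es.
apply/eqP; rewrite -subr_eq0; apply/eqP; apply: near_eq0P => e e0.
have e20 : 0 < e / 2 by rewrite divr_gt0.
have cvw a b : {for x, continuous ('D_b ('D_a f))} by apply: ((Cf a).2.2 b).2.1.
have [r0 r00 H0] := @near_parallelogram _ _ _ x v w NU.
have [r1 r10 H1] := continuous_parallelogram v w (cvw v w) e20.
have [r2 r20 H2] := continuous_parallelogram w v (cvw w v) e20.
pose h := Num.min r0 (Num.min r1 r2).
have h0 : 0 < h by rewrite !lt_min r00 r10 r20.
have [hr0 hr1 hr2] : [/\ h <= r0, h <= r1 & h <= r2].
  by split; rewrite /h !ge_min lexx ?orbT.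
have B s r : 0 <= s <= h -> h <= r -> 0 <= s <= r.
  by move=> /andP[-> /= /le_trans]; apply.
have [s [t [sh th E1]]] : exists s t, [/\ 0 <= s <= h, 0 <= t <= h &
      f (x + h *: v + h *: w) - f (x + h *: v) - (f (x + h *: w) - f x) =
      h ^+ 2 * 'D_w ('D_v f) (x + s *: v + t *: w)].
  by apply: diff2 => // s t sh th; apply: H0; exact: B.
have [s' [t' [sh' th' E2]]] : exists s t, [/\ 0 <= s <= h, 0 <= t <= h &
      f (x + h *: w + h *: v) - f (x + h *: w) - (f (x + h *: v) - f x) =
      h ^+ 2 * 'D_v ('D_w f) (x + s *: w + t *: v)].
  by apply: diff2 => // s' t' sh' th'; rewrite addrAC; apply: H0; exact: B.
have E : 'D_w ('D_v f) (x + s *: v + t *: w) = 'D_v ('D_w f) (x + s' *: w + t' *: v).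
  apply: (@mulfI _ (h ^+ 2)); first by rewrite expf_neq0 // gt_eqF.
  apply: etrans (etrans (esym E1) _) E2.
  by rewrite subrACA (addrAC x (h *: w)).
have I1 := H1 s t (B _ _ sh hr1) (B _ _ th hr1).
have I2 := H2 s' t' (B _ _ sh' hr2) (B _ _ th' hr2).
exact: (norm_le_limit2 E I1 I2).
Qed.

(** * Locality of the classes [Ck] and bilinearity of second derivatives *)

Lemma Ck_eq_on (R : realType) (V : normedModType R) (k : nat) (U : set V) (f g : V -> R) :
  open U -> (forall x, U x -> f x = g x) -> Ck k U f -> Ck k U g.
Proof.
move=> oU; elim: k f g => [|k IH] f g fg Cf.
  split=> // x Ux; suff : g @ x --> f x by rewrite fg.
  have NU : \forall y \near x, U y by exact: open_nbhs_nbhs.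
  by apply: cvg_trans (Cf.1 x Ux); apply: near_eq_cvg; exact: filterS NU.
have E x : U x -> \forall y \near x, f y = g y.
  move=> Ux; have NU : \forall y \near x, U y by exact: open_nbhs_nbhs.
  exact: filterS NU.
split.
  move=> x Ux; suff : g @ x --> f x by rewrite fg.
  by apply: cvg_trans (Cf.1 x Ux); apply: near_eq_cvg; exact: E.
move=> v; split=> [x Ux|].
  by apply: near_eq_derivable (E x Ux) _; apply: (Cf.2 v).1.
apply: IH (Cf.2 v).2 => x Ux.
exact: near_eq_derive (E x Ux).
Qed.

(** Each clause of [Ck] is a condition at single points, so it can be checked in a different set
    around each of them. *)
Lemma Ck_local (R : realType) (V : normedModType R) (k : nat) (U : set V) (f : V -> R) :
  (forall x, U x -> exists2 W : set V, W x & Ck k W f) -> Ck k U f.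
Proof.
elim: k f => [|k IH] f H; split=> //.
- by move=> x /H[W Wx CW]; exact: CW.1.
- by move=> x /H[W Wx CW]; exact: CW.1.
move=> v; split=> [x /H[W Wx CW]|]; first exact: (CW.2 v).1.
by apply: IH => x /H[W Wx CW]; exists W => //; exact: (CW.2 v).2.
Qed.

Lemma Ck_sub (R : realType) (V : normedModType R) (k : nat) (U W : set V) (f : V -> R) :
  W `<=` U -> Ck k U f -> Ck k W f.
Proof. by move=> WU CU; apply: Ck_local => x Wx; exists U => //; exact: WU. Qed.

Lemma Ck_pred (R : realType) (V : normedModType R) (k : nat) (U : set V) (f : V -> R) :
  Ck k.+1 U f -> Ck k U f.
Proof.
elim: k f => [|k IH] f [cf Cf]; split=> // v.
by have [df Cdf] := Cf v; split=> //; exact: IH.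
Qed.

(** Coordinate-free second derivative, used for functions of x and of (x, t) alike. *)
Definition hess (R : realType) (V : normedModType R) (f : V -> R) (x v w : V) : R :=
  'D_w ('D_v f) x.

Lemma hessC (R : realType) (V : normedModType R) (U : set V) (f : V -> R) (x v w : V) :
  open U -> U x -> Ck 2 U f -> hess f x v w = hess f x w v.
Proof. exact: derive_dirC. Qed.

Lemma hessDr (R : realType) (V : normedModType R) (U : set V) (f : V -> R) (x v w z : V) :
  open U -> U x -> Ck 2 U f -> hess f x v (w + z) = hess f x v w + hess f x v z.
Proof. by move=> oU Ux [_ Cf]; apply: derive_dirD oU Ux (Cf v).2. Qed.

Lemma hessZr (R : realType) (V : normedModType R) (U : set V) (f : V -> R) (x v w : V) (k : R) :
  U x -> Ck 2 U f -> hess f x v (k *: w) = k * hess f x v w.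
Proof.
move=> Ux [_ Cf]; apply: derive_dirZ; have [_ [_ /(_ w)[+ _]]] := Cf v; exact.
Qed.

Lemma hessDl (R : realType) (V : normedModType R) (U : set V) (f : V -> R) (x v w z : V) :
  open U -> U x -> Ck 2 U f -> hess f x (w + z) v = hess f x w v + hess f x z v.
Proof. by move=> oU Ux Cf; rewrite !(@hessC _ _ U f x _ v) // (@hessDr _ _ U). Qed.

Lemma hessZl (R : realType) (V : normedModType R) (U : set V) (f : V -> R) (x v w : V) (k : R) :
  open U -> U x -> Ck 2 U f -> hess f x (k *: w) v = k * hess f x w v.
Proof. by move=> oU Ux Cf; rewrite !(@hessC _ _ U f x _ v) // (@hessZr _ _ U). Qed.

(** * Second-order conditions along lines *)

(** The first derivative vanishes at 0. If p2 > 0 it is positive just to the right of 0, and the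
    mean value theorem yields a value above phi(0). *)
Lemma second_derivative_at_max (R : realType) (phi phi1 : R -> R) (p2 : R) :
  (\forall s \near (0 : R), is_derive (s : R) 1 phi (phi1 s)) ->
  is_derive (0 : R) 1 phi1 p2 ->
  (\forall s \near (0 : R), phi s <= phi 0) -> p2 <= 0.
Proof.
move=> d1 d2 mx.
have [r r0 Hr] : exists2 r : R, 0 < r & forall s : R, `|s| < r ->
    is_derive s 1 phi (phi1 s) /\ phi s <= phi 0.
  have /nbhs_ballP[r /= r0 rP] : \forall s \near (0 : R), is_derive (s : R) 1 phi (phi1 s) /\ phi s <= phi 0.
    by near=> s; split; near: s.
  by exists r => // s sr; apply: rP; rewrite -ball_normE /= sub0r normrN.
have in_r s : s \in `]- r, r[%R -> `|s| < r by rewrite in_itv /= ltr_norml.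
have p10 : phi1 0 = 0.
  have d0 : is_derive (0 : R) 1 phi (phi1 0) by apply: (Hr 0 _).1; rewrite normr0.
  rewrite -(@derive_val _ _ _ _ _ _ _ d0).
  have r02 : - r <= r by lra.
  have : is_derive (0 : R) 1 phi 0.
    apply: (@derive1_at_max _ phi (- r) r) => //.
    - by move=> s /in_r/Hr[ds _]; apply: ex_derive.
    - by rewrite in_itv /= oppr_lt0 r0.
    - by move=> s /in_r/Hr[].
  by move=> dd; rewrite (@derive_val _ _ _ _ _ _ _ dd).
rewrite leNgt; apply/negP => p2pos.
have dv : 'D_1 phi1 (0 : R) = p2 by exact: derive_val.
have cv : (fun h : R => h^-1 *: ((phi1 \o shift 0) (h *: 1) - phi1 0)) @ 0^' --> p2.
  by rewrite -dv; exact: ex_derive.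
have : \forall h \near (0 : R)^', 0 < h^-1 *: ((phi1 \o shift 0) (h *: 1) - phi1 0).
  by apply: (cvgr_gt _ cv).
rewrite /= near_withinE => /nbhs_ballP[q /= q0 qP].
have phi1_pos s : 0 < s < q -> 0 < phi1 s.
  move=> /andP[s0 sq].
  have : ball (0 : R) q s by rewrite -ball_normE /= sub0r normrN gtr0_norm.
  move=> /qP; rewrite gt_eqF // => /(_ isT).
  have s1 : s *: (1 : R) = s by exact: mulr1.
  by rewrite p10 subr0 addr0 s1 pmulr_rgt0 // invr_gt0.
pose m := Num.min q r / 2.
have m0 : 0 < m by rewrite divr_gt0 // lt_min q0 r0.
have [mq mr] : m < q /\ m < r.
  have : m < Num.min q r by rewrite ltr_pdivrMr // ltr_pMr ?lt_min ?q0 ?r0 // ltr1n.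
  by rewrite lt_min => /andP[].
have ds s : s \in `]0, m[%R -> is_derive s 1 phi (phi1 s).
  rewrite in_itv /= => /andP[s0 sm]; apply: (Hr s _).1.
  by rewrite gtr0_norm //; exact: lt_trans mr.
have cs : {within `[0, m], continuous phi}.
  apply: derivable_within_continuous => s; rewrite in_itv /= => /andP[s0 sm].
  apply: ex_derive; apply: (Hr s _).1.
  by rewrite ger0_norm //; exact: le_lt_trans mr.
have [c] := MVT m0 ds cs.
rewrite in_itv /= subr0 => /andP[c0 cm] E.
have : phi m <= phi 0 by apply: (Hr m _).2; rewrite gtr0_norm.
rewrite -subr_le0 E leNgt mulr_gt0 // phi1_pos // c0 /=.
exact: lt_trans mq.
Unshelve. all: by end_near. Qed.

Lemma near_line (R : realType) (V : normedModType R) (P : set V) (x v : V) :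
  (\forall y \near x, P y) -> \forall s \near (0 : R), P (x + s *: v).
Proof.
move=> Px; have c : (fun s : R => x + s *: v) @ 0 --> x.
  rewrite -[X in _ --> X]addr0 -[X in _ --> _ + X](scale0r v).
  by apply: cvgD; [exact: cvg_cst | apply: cvgZr_tmp; exact: cvg_id].
exact: c.
Qed.

Lemma is_derive_mean (R : realType) (N : nat) (f : 'I_N -> R -> R) (df : 'I_N -> R) (x : R) :
  (forall i, is_derive x 1 (f i) (df i)) ->
  is_derive x 1 (fun s : R => mean (fun i => f i s)) (mean df).
Proof.
move=> H; have := is_deriveZ (N%:R^-1 : R) (is_derive_sum H).
rewrite (_ : _ \*: _ = (fun s : R => mean (fun i => f i s))) //.
by apply/funext => s; rewrite /= fct_sumE.
Qed.

Lemma is_derive_quadratic (R : realType) (k1 k2 s : R) :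
  is_derive s 1 (fun s : R => k1 * s + k2 * s ^+ 2) (k1 + k2 * (2 * s)).
Proof.
have d1 := is_derive_mulr0 k1 s.
have d2 : is_derive s 1 (fun s : R => k2 * s ^+ 2) (k2 * (2 * s)).
  have dX : is_derive s 1 (fun s : R => s ^+ 2) (2 * s).
    apply: DeriveDef; first exact: exprn_derivable.
    by rewrite exp_derive expr1 [LHS]mulr1.
  by have := is_deriveZ k2 dX.
exact: is_deriveD d1 d2.
Qed.

(** Second derivative test in s along lines through all the points at once. The polynomial k1 s + k2
    s^2 leaves room for explicit terms of the maximized function; only k2 reaches second order. *)
Lemma hess_mean_at_max (R : realType) (V : normedModType R) (U : set V) (f : V -> R)
    (N : nat) (P d : V) (p_ d_ : 'I_N -> V) (k1 k2 : R) :
  open U -> Ck 2 U f -> U P -> (forall i, U (p_ i)) ->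
  (\forall s \near (0 : R),
    f (P + s *: d) - mean (fun i => f (p_ i + s *: d_ i)) + (k1 * s + k2 * s ^+ 2)
    <= f P - mean (fun i => f (p_ i))) ->
  hess f P d d + 2 * k2 <= mean (fun i => hess f (p_ i) (d_ i) (d_ i)).
Proof.
move=> oU Cf UP Up mx.
have NU x v : U x -> \forall s \near (0 : R), U (x + s *: v).
  by move=> Ux; apply: near_line; exact: open_nbhs_nbhs.
have d1 x v s : U (x + s *: v) ->
    is_derive s 1 (fun s : R => f (x + s *: v)) ('D_v f (x + s *: v)).
  by move=> Ux; apply: is_derive_line; apply: (Cf.2 v).1.
have d2 x v : U x ->
    is_derive (0 : R) 1 (fun s : R => 'D_v f (x + s *: v)) (hess f x v v).
  move=> Ux; rewrite {2}(_ : x = x + (0 : R) *: v); last by rewrite scale0r addr0.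
  apply: is_derive_line; rewrite scale0r addr0.
  by apply: ((Cf.2 v).2.2 v).1.
rewrite -subr_le0.
pose phi (s : R) := f (P + s *: d) - mean (fun i => f (p_ i + s *: d_ i)) + (k1 * s + k2 * s ^+ 2).
pose phi1 (s : R) := 'D_d f (P + s *: d)
  - mean (fun i => 'D_(d_ i) f (p_ i + s *: d_ i)) + (k1 + k2 * (2 * s)).
apply: (@second_derivative_at_max _ phi phi1).
- near=> s; apply: is_deriveD (is_derive_quadratic k1 k2 s).
  apply: is_deriveB.
    by apply: d1; near: s; exact: NU.
  apply: is_derive_mean => i; apply: d1; move: i; near: s.
  by apply: filter_forall => i; exact: NU.
- have d3 : is_derive (0 : R) 1 (fun s : R => k1 + k2 * (2 * s)) (2 * k2).
    have := is_derive_mulr0 (2 * k2) 0.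
    move=> /(is_deriveD (is_derive_cst k1 (0 : R) (1 : R))).
    rewrite add0r (_ : _ + _ = (fun s : R => k1 + k2 * (2 * s))) //.
    by apply/funext => s /=; rewrite mulrA [k2 * 2]mulrC.
  have d4 := is_deriveB (d2 P d UP) (is_derive_mean (fun i => d2 (p_ i) (d_ i) (Up i))).
  rewrite addrAC; exact: is_deriveD d4 d3.
apply: filterS mx => s; rewrite /phi scale0r addr0.
rewrite (@eq_mean _ _ (fun i => f (p_ i + (0 : R) *: d_ i)) (fun i => f (p_ i))); last first.
  by move=> i; rewrite scale0r addr0.
by rewrite !(expr0n, mulr0, addr0).
Unshelve. all: by end_near. Qed.

Lemma taylor1_ge (R : realType) (V : normedModType R) (f : V -> R) (x d : V) (c : R) :
  Ck 2 setT f -> (forall y, - c <= hess f y d d) ->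
  f x + 'D_d f x - c / 2 <= f (x + d).
Proof.
move=> Cf Hc.
(* Adding c s^2 / 2 makes the restriction to the line convex, so its increment over [0, 1] is at
   least its slope at 0. *)
pose psi (s : R) : R := f (x + s *: d) + (0 * s + c / 2 * s ^+ 2).
pose psi1 (s : R) : R := 'D_d f (x + s *: d) + (0 + c / 2 * (2 * s)).
have d1 (s : R) : is_derive s 1 psi (psi1 s).
  apply: is_deriveD (is_derive_quadratic _ _ s).
  by apply: is_derive_line; exact: (Cf.2 d).1.
have d2 (s : R) : is_derive s 1 psi1 (hess f (x + s *: d) d d + c).
  apply: is_deriveD; first by apply: is_derive_line; exact: ((Cf.2 d).2.2 d).1.
  rewrite (_ : (fun s : R => 0 + c / 2 * (2 * s)) = (fun s => c * s)).
    exact: is_derive_mulr0.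
  by apply/funext => r; lra.
have ct (g dg : R -> R) a b : (forall s : R, is_derive s 1 g (dg s)) -> {within `[a, b], continuous g}.
  by move=> dgs; apply: derivable_within_continuous => s _; apply: ex_derive.
have [s] := MVT_segment ler01 (fun s _ => d1 s) (ct _ _ 0 1 d1).
rewrite in_itv /= => /andP[s0 _] E1.
have [r] := MVT_segment s0 (fun s _ => d2 s) (ct _ _ 0 s d2).
rewrite in_itv /= => _ E2.
have : 0 <= psi1 s - psi1 0.
  by rewrite E2 subr0 mulr_ge0 //; have := Hc (x + r *: d); lra.
move: E1; rewrite /psi /psi1 !scale1r !scale0r !addr0.
move: (f x) (f (x + d)) ('D_d f x) ('D_d f _) => a b e g; lra.
Qed.

(** * Semiconvexity and Jensen's inequality *)

Definition vmean (R : realFieldType) (V : lmodType R) (N : nat) (x : 'I_N -> V) : V :=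
  N%:R^-1 *: \sum_i x i.

(** Squared Euclidean norm; the norm carried by ['rV[R]_n] is the maximum norm. *)
Definition sqn (R : realFieldType) (n : nat) (v : 'rV[R]_n) : R := \sum_j v 0 j ^+ 2.

Lemma sqn_ge0 (R : realFieldType) (n : nat) (v : 'rV[R]_n) : 0 <= sqn v.
Proof. by apply: sumr_ge0 => j _; exact: sqr_ge0. Qed.

Lemma sqnZ (R : realFieldType) (n : nat) (k : R) (v : 'rV[R]_n) :
  sqn (k *: v) = k ^+ 2 * sqn v.
Proof. by rewrite /sqn mulr_sumr; apply: eq_bigr => j _; rewrite mxE exprMn. Qed.

Lemma vmeanE (R : realFieldType) (n N : nat) (x : 'I_N -> 'rV[R]_n) j :
  vmean x 0 j = mean (fun i => x i 0 j).
Proof. by rewrite /vmean mxE summxE. Qed.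

Lemma sum_sub_vmean (R : realFieldType) (V : lmodType R) (N : nat) (x : 'I_N -> V) :
  (0 < N)%N -> \sum_i (x i - vmean x) = 0.
Proof.
move=> N0; rewrite sumrB sumr_const card_ord /vmean -scaler_nat scalerA.
by rewrite divff ?scale1r ?subrr // pnatr_eq0 -lt0n.
Qed.

Lemma derive_dir_sum (R : realType) (V : normedModType R) (U : set V) (f : V -> R)
    (x : V) (I : Type) (r : seq I) (v : I -> V) :
  open U -> U x -> Ck 1 U f -> 'D_(\sum_(i <- r) v i) f x = \sum_(i <- r) 'D_(v i) f x.
Proof.
move=> oU Ux Cf; apply: (big_morph (fun v => 'D_v f x)); last exact: derive0.
by move=> w z; exact: derive_dirD oU Ux Cf.
Qed.

Lemma quadratic_form_mxE (R : comPzRingType) (n : nat) (H : 'rV[R]_n -> 'rV[R]_n -> R)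
    (v : 'rV[R]_n) :
  (forall v w z, H v (w + z) = H v w + H v z) ->
  (forall v w z, H (w + z) v = H w v + H z v) ->
  (forall v w k, H v (k *: w) = k * H v w) ->
  (forall v w k, H (k *: w) v = k * H w v) ->
  (v *m (\matrix_(i, j) H (delta_mx 0 i) (delta_mx 0 j)) *m v^T) 0 0 = H v v.
Proof.
move=> Dr Dl Zr Zl.
have Sr w (F : 'I_n -> 'rV[R]_n) : H w (\sum_i F i) = \sum_i H w (F i).
  apply: (big_morph (H w)); first by move=> *; exact: Dr.
  by rewrite -(scale0r (0 : 'rV[R]_n)) Zr mul0r.
have Sl w (F : 'I_n -> 'rV[R]_n) : H (\sum_i F i) w = \sum_i H (F i) w.
  apply: (big_morph (H^~ w)); first by move=> *; exact: Dl.
  by rewrite -(scale0r (0 : 'rV[R]_n)) Zl mul0r.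
rewrite [in RHS](row_sum_delta v) Sr mxE; apply: eq_bigr => j _.
rewrite Zr Sl mxE [v^T _ _]mxE mulrC; congr (_ * _); apply: eq_bigr => i _.
by rewrite Zl mxE.
Qed.

Lemma mx_form_shift (R : realType) (n : nat) (M : 'M[R]_n) (lam : R) (v : 'rV[R]_n) :
  (v *m (M + 1%:M - lam%:M) *m v^T) 0 0 = (v *m M *m v^T) 0 0 + (1 - lam) * sqn v.
Proof.
rewrite -addrA -raddfB /= mulmxDr mulmxDl mxE; congr (_ + _).
rewrite mul_mx_scalar -scalemxAl mxE; congr (_ * _); rewrite mxE.
by apply: eq_bigr => j _; rewrite [v^T _ _]mxE expr2.
Qed.

Lemma hessianE (R : realType) (n : nat) (f : 'rV[R]_n -> R) (x v : 'rV[R]_n) :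
  Ck 2 setT f -> (v *m hessian f x *m v^T) 0 0 = hess f x v v.
Proof.
move=> Cf; apply: (@quadratic_form_mxE _ _ (hess f x)).
- by move=> w y z; apply: hessDr Cf => //; exact: openT.
- by move=> w y z; apply: hessDl Cf => //; exact: openT.
- by move=> w y k; apply: hessZr Cf.
- by move=> w y k; apply: hessZl Cf => //; exact: openT.
Qed.

Lemma hessian_xE (R : realType) (n : nat) (U : set ('rV[R]_n * R)) (u : 'rV[R]_n * R -> R)
    (p : 'rV[R]_n * R) (v : 'rV[R]_n) :
  open U -> U p -> Ck 2 U u ->
  (v *m hessian_x u p *m v^T) 0 0 = hess u p (v, 0) (v, 0).
Proof.
move=> oU Up Cu.
have pD (w z : 'rV[R]_n) : (w + z, 0 : R) = (w, 0) + (z, 0).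
  by congr pair; rewrite addr0.
have pZ (w : 'rV[R]_n) (k : R) : (k *: w, 0 : R) = k *: (w, 0).
  by congr pair; rewrite /= scaler0.
apply: (@quadratic_form_mxE _ _ (fun v w => hess u p (v, 0) (w, 0))).
- by move=> w y z; rewrite pD (hessDr _ _ _ oU Up Cu).
- by move=> w y z; rewrite pD (hessDl _ _ _ oU Up Cu).
- by move=> w y k; rewrite pZ (hessZr _ _ _ Up Cu).
- by move=> w y k; rewrite pZ (hessZl _ _ _ oU Up Cu).
Qed.

(** Expand f at the mean towards each x_i and average: the first-order terms cancel because the
    deviations from the mean sum to zero. *)
Lemma jensen_semiconvex (R : realType) (n N : nat) (f : 'rV[R]_n -> R) (kap : R)
    (x : 'I_N -> 'rV[R]_n) :
  (0 < N)%N -> Ck 2 setT f -> (forall y v, - (kap * sqn v) <= hess f y v v) ->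
  f (vmean x) <= mean (fun i => f (x i)) + kap / 2 * mean (fun i => sqn (x i - vmean x)).
Proof.
move=> N0 Cf Hf.
have H i : f (vmean x) <= - 'D_(x i - vmean x) f (vmean x) +
    (f (x i) + kap / 2 * sqn (x i - vmean x)).
  have := taylor1_ge (vmean x) Cf (fun y => Hf y (x i - vmean x)).
  rewrite [vmean x + _]addrC subrK.
  move: (f _) (f _) ('D_ _ f _) (sqn _) => a b c d; lra.
rewrite -meanZ -meanD -[X in X <= _](mean_cst _ N0) -[X in _ <= X]add0r.
have <- : mean (fun i => - 'D_(x i - vmean x) f (vmean x)) = 0.
  rewrite /mean sumrN -(derive_dir_sum _ _ openT I (Ck_pred Cf)) sum_sub_vmean //.
  by rewrite derive0 oppr0 mulr0.
by rewrite -meanD; exact: ler_mean.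
Qed.

(** * Functions on the slab *)

Definition slab (R : realType) (n : nat) : set ('rV[R]_n * R) := [set p | 0 <= p.2 <= 1].
Definition open_slab (R : realType) (n : nat) : set ('rV[R]_n * R) := [set p | 0 < p.2 < 1].

Lemma open_open_slab (R : realType) (n : nat) : open (@open_slab R n).
Proof.
have -> : @open_slab R n = snd @^-1` `]0, 1[.
  by apply/seteqP; split => p; rewrite /open_slab /= in_itv.
apply: open_comp; last exact: interval_open.
by move=> p _; exact: cvg_snd.
Qed.

Lemma open_slab_sub (R : realType) (n : nat) : @open_slab R n `<=` @slab R n.
Proof. by move=> p /andP[a b]; apply/andP; split; exact: ltW. Qed.

(** Values of [u] outside the closed slab are arbitrary, so derivatives of [u] itself are controlled
    in the open slab only; near a boundary point they are read off from the extension [F]. *)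
Lemma smooth_slab_local (R : realType) (n : nat) (u : 'rV[R]_n * R -> R) p :
  smooth_on (@slab R n) u -> slab p ->
  exists (U : set ('rV[R]_n * R)) F, [/\ open U, U p, Ck 2 U F,
    forall q, U q -> slab q -> F q = u q & Ck 2 (U `&` @open_slab R n) u].
Proof.
move=> su /su[U [F [oU Up sF Fu]]]; exists U, F; split=> //.
apply: (@Ck_eq_on _ _ _ _ F) (Ck_sub _ (sF 2%N)).
- by apply: openI => //; exact: open_open_slab.
- by move=> q [Uq /open_slab_sub]; exact: Fu.
- by move=> q [].
Qed.

Lemma smooth_slab_interior (R : realType) (n : nat) (u : 'rV[R]_n * R -> R) :
  smooth_on (@slab R n) u -> Ck 2 (@open_slab R n) u.
Proof.
move=> su; apply: Ck_local => p op.
have [U [F [oU Up _ _ Cu]]] := smooth_slab_local su (open_slab_sub op).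
by exists (U `&` @open_slab R n).
Qed.

(** The point p may lie on the boundary. At nearby interior points the second derivatives of [u] are
    those of the extension, which are continuous at p. *)
Lemma hess_locally_bounded (R : realType) (n : nat) (u : 'rV[R]_n * R -> R) v w p :
  smooth_on (@slab R n) u -> slab p ->
  exists C, \forall q \near p, open_slab q -> `|hess u q v w| <= C.
Proof.
move=> su /(smooth_slab_local su)[U [F [oU Up CF Fu Cu]]].
exists (`|hess F p v w| + 1).
have cF : {for p, continuous (fun q => hess F q v w)} by apply: ((CF.2 v).2.2 w).2.1.
have /cvgrPdist_le/(_ 1 ltr01) cF1 := cF.
have NU : \forall q \near p, U q by exact: open_nbhs_nbhs.
near=> q => oq.
have Uq : U q by near: q.
have E : \forall z \near q, F z = u z.
  have : \forall z \near q, (U `&` @open_slab R n) z.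
    by apply: open_nbhs_nbhs; split=> //; apply: openI => //; exact: open_open_slab.
  by apply: filterS => z [Uz /open_slab_sub]; exact: Fu.
have -> : hess u q v w = hess F q v w.
  rewrite /hess; apply: near_eq_derive.
  (* The inner derivative has to agree at all points near q, so equality is needed near each such
     point. *)
  have : \forall z \near q, \forall y \near z, F y = u y by exact: near_join.
  by apply: filterS => z Ez; apply: near_eq_derive; apply: filterS Ez.
rewrite -[hess F q v w](subrK (hess F p v w)) addrC.
apply: (le_trans (ler_normD _ _)); rewrite lerD2l distrC.
by near: q.
Unshelve. all: by end_near. Qed.

Lemma ex_shift_unit (R : realType) (n : nat) (x : 'rV[R]_n) :
  exists k : 'rV[int]_n, forall j, 0 <= (x + map_mx intr k) 0 j <= 1.
Proof.
exists (\row_j - Num.floor (x 0 j)) => j; rewrite !mxE mulrNz.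
have := floor_le (x 0 j); have := floorD1_gt (x 0 j).
by rewrite intrD => a b; apply/andP; split; lra.
Qed.

Lemma unit_box_compact (R : realType) (n : nat) :
  compact [set p : 'rV[R]_n * R | (forall j, 0 <= p.1 0 j <= 1) /\ 0 <= p.2 <= 1].
Proof.
have c1 := @segment_compact R 0 1.
have := compact_setX (rV_compact (fun _ : 'I_n => c1)) c1.
by congr compact; apply/seteqP; split => p /=; rewrite ?in_itv /= => -[H1 H2]; split=> // j;
  have := H1 j; rewrite /= in_itv.
Qed.

(** Integer translations reduce to the compact unit box, where local bounds become uniform. Bounds
    are asked near every point of the closed slab but only on [S], so that [S] may be the open
    slab. *)
Lemma periodic_bounded (R : realType) (n : nat) (S : set ('rV[R]_n * R)) (G : 'rV[R]_n * R -> R) :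
  S `<=` @slab R n ->
  (forall p, slab p -> exists C, \forall q \near p, S q -> `|G q| <= C) ->
  (forall (k : 'rV[int]_n) x t, S (x, t) ->
    S (x + map_mx intr k, t) /\ G (x + map_mx intr k, t) = G (x, t)) ->
  exists C, forall q, S q -> `|G q| <= C.
Proof.
move=> Ss Gloc Gper.
have /compact_near_coveringP K := @unit_box_compact R n.
have [] := @K R +oo%R (fun C q => S q -> `|G q| <= C) _.
  move=> p [_ p2]; have [C HC] := Gloc p p2.
  exists ([set q | S q -> `|G q| <= C], [set D | C <= D]).
    by split=> //; apply: nbhs_pinfty_ge; exact: num_real.
  by move=> [q D] /= [Hq CD] Sq; exact: le_trans (Hq Sq) CD.
(* The neighbourhood of +oo provides bounds strictly beyond M only. *)
move=> M [_ HM]; exists (M + 1) => -[x t] Sq.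
have [k Hk] := ex_shift_unit x.
have [Sk <-] := Gper k x t Sq.
have MM : M < M + 1 by rewrite ltrDl.
by apply: (HM _ MM) => //; split=> //; exact: (Ss _ Sk).
Qed.

Lemma derive_translate (R : realType) (V : normedModType R) (f : V -> R) (K v p : V) :
  'D_v f (p + K) = 'D_v (fun q => f (q + K)) p.
Proof.
have E : (fun h : R => h^-1 *: ((f \o shift (p + K)) (h *: v) - f (p + K))) =
  (fun h : R => h^-1 *: (((fun q => f (q + K)) \o shift p) (h *: v) - f (p + K))).
  by apply/funext => h /=; rewrite addrA.
by rewrite /derive E.
Qed.

Lemma hess_periodic (R : realType) (n : nat) (u : 'rV[R]_n * R -> R) v w
    (k : 'rV[int]_n) x t :
  (forall t, 0 <= t <= 1 -> Zperiodic (fun x => u (x, t))) ->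
  0 < t < 1 -> hess u (x + map_mx intr k, t) v w = hess u (x, t) v w.
Proof.
move=> per t01.
have E y s : (y + map_mx intr k, s) = (y, s) + (map_mx intr k : 'rV[R]_n, 0 : R).
  by congr pair; rewrite /= addr0.
have uE q : open_slab q -> u (q + (map_mx intr k : 'rV[R]_n, 0 : R)) = u q.
  by case: q => y s /open_slab_sub /= s01; rewrite -E; exact: per.
have NO q : open_slab q -> \forall z \near q, @open_slab R n z.
  by move=> oq; apply: open_nbhs_nbhs; split=> //; exact: open_open_slab.
rewrite E /hess derive_translate; apply: near_eq_derive.
have := NO (x, t) t01; apply: filterS => q oq; rewrite derive_translate.
by apply: near_eq_derive; have := NO q oq; apply: filterS uE.
Qed.

(* [u] is controlled on the closed slab only; [u (x, clamp t)] extends it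
   continuously to the whole space. *)
Definition clamp (R : realType) (t : R) : R := Num.max 0 (Num.min 1 t).

Lemma clamp_bound (R : realType) (t : R) : 0 <= clamp t <= 1.
Proof. by rewrite /clamp le_max lexx ge_max ler01 ge_min lexx. Qed.

Lemma clamp_id (R : realType) (t : R) : 0 <= t <= 1 -> clamp t = t.
Proof. by move=> /andP[t0 t1]; rewrite /clamp min_r // max_r. Qed.

Lemma clamp_continuous (R : realType) : continuous (@clamp R).
Proof.
move=> t; apply: continuous_max; first exact: cvg_cst.
by apply: continuous_min; [exact: cvg_cst | exact: cvg_id].
Qed.

Lemma smooth_slab_continuous (R : realType) (n : nat) (u : 'rV[R]_n * R -> R) :
  smooth_on (@slab R n) u ->
  continuous (fun p : 'rV[R]_n * R => u (p.1, clamp p.2)).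
Proof.
move=> su p.
pose c (q : 'rV[R]_n * R) := (q.1, clamp q.2).
have cc : continuous c.
  move=> q; have c1 : fst z @[z --> q] --> q.1 by exact: cvg_fst.
  have c2 : snd z @[z --> q] --> q.2 by exact: cvg_snd.
  have c3 : clamp (snd z) @[z --> q] --> clamp q.2.
    exact: (cvg_comp _ _ c2 (@clamp_continuous R q.2)).
  exact: (cvg_pair c1 c3).
have sc q : slab (c q) by exact: clamp_bound.
have [U [F [oU Up CF Fu _]]] := smooth_slab_local su (sc p).
have cF : {for c p, continuous F} by exact: CF.1.
have Fc : (F \o c) q @[q --> p] --> F (c p) by apply: cvg_comp (cc p) cF.
suff : u (c q) @[q --> p] --> F (c p) by rewrite (Fu _ Up (sc p)).
apply: cvg_trans Fc.
apply: near_eq_cvg.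
have NU : nbhs (c p) U by exact: open_nbhs_nbhs.
have NUc : \forall q \near p, U (c q) by exact: cc p U NU.
near=> q; apply: (Fu _ _ (sc q)); near: q; exact: NUc.
Unshelve. all: by end_near. Qed.

(** * Maximizing the gap *)

(** With v = u + kap |x|^2 / 2 this is v(mean) - mean v + dl t (t - 1). Writing the quadratic part
    as a variance shows its invariance under a common integer translation of all the points. *)
Definition gap (R : realType) (n N : nat) (u : 'rV[R]_n * R -> R) (kap dl : R)
    (X : 'I_N -> 'rV[R]_n) (t : R) : R :=
  u (vmean X, t) - mean (fun i => u (X i, t))
  - kap / 2 * mean (fun i => sqn (X i - vmean X)) + dl * (t * (t - 1)).

Lemma eq_gap (R : realType) (n N : nat) (u v : 'rV[R]_n * R -> R) kap dl
    (X : 'I_N -> 'rV[R]_n) t :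
  (forall x, u (x, t) = v (x, t)) -> gap u kap dl X t = gap v kap dl X t.
Proof. by move=> uv; rewrite /gap uv; congr (_ - _ - _ + _); apply: eq_mean => i. Qed.

Lemma vmean_shift (R : realFieldType) (V : lmodType R) (N : nat) (X : 'I_N -> V) (k : V) :
  (0 < N)%N -> vmean (fun i => X i + k) = vmean X + k.
Proof.
move=> N0; rewrite /vmean big_split /= scalerDr sumr_const card_ord -[k *+ N]scaler_nat scalerA.
by rewrite mulVf ?scale1r // pnatr_eq0 -lt0n.
Qed.

Lemma gap_shift (R : realType) (n N : nat) (u : 'rV[R]_n * R -> R) kap dl
    (X : 'I_N -> 'rV[R]_n) t (k : 'rV[int]_n) :
  (0 < N)%N -> Zperiodic (fun x => u (x, t)) ->
  gap u kap dl (fun i => X i + map_mx intr k) t = gap u kap dl X t.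
Proof.
move=> N0 per; rewrite /gap vmean_shift // per; congr (_ - _ - _ * _ + _).
  by apply: eq_mean => i; exact: per.
by apply: eq_mean => i; rewrite opprD addrACA subrr addr0.
Qed.

Lemma mean_continuous (R : realType) (T : topologicalType) (N : nat) (f : 'I_N -> T -> R) :
  (forall i, continuous (f i)) -> continuous (fun x => mean (fun i => f i x)).
Proof.
move=> cf x; apply: cvgM; first exact: cvg_cst.
by apply: cvg_big; [exact: add_continuous | move=> i _; exact: cf].
Qed.

Lemma vmean_continuous (R : realType) (V : normedModType R) (T : topologicalType) (N : nat)
    (f : 'I_N -> T -> V) :
  (forall i, continuous (f i)) -> continuous (fun x => vmean (fun i => f i x)).
Proof.
move=> cf x; apply: cvgZ; first exact: cvg_cst.
by apply: cvg_big; [exact: add_continuous | move=> i _; exact: cf].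
Qed.

Lemma sqn_continuous (R : realType) (n : nat) : continuous (@sqn R n).
Proof.
apply: (@continuous_big _ _ +%R 0 xpredT add_continuous _ (index_enum 'I_n)
  (fun j (w : 'rV[R]_n) => w 0 j ^+ 2)) => j _ v.
have c : w 0 j @[w --> v] --> v 0 j by exact: coord_continuous.
exact: (cvgM c c).
Qed.

Lemma gap_continuous (R : realType) (n N : nat) (u : 'rV[R]_n * R -> R) kap dl :
  continuous u ->
  continuous (fun z : prod_topology (fun _ : 'I_N => 'rV[R]_n) * R => gap u kap dl z.1 z.2).
Proof.
move=> cu.
pose T := (prod_topology (fun _ : 'I_N => 'rV[R]_n) * R)%type.
have c2 : continuous (snd : T -> R) by move=> z; exact: cvg_snd.
have cX i : continuous (fun z : T => z.1 i).
  move=> z; have c1 : fst w @[w --> z] --> z.1 by exact: cvg_fst.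
  exact: (cvg_comp _ _ c1 (@proj_continuous _ (fun _ : 'I_N => 'rV[R]_n) i z.1)).
have cm : continuous (fun z : T => vmean z.1) by exact: (vmean_continuous cX).
have cuc (g : T -> 'rV[R]_n) : continuous g -> continuous (fun z : T => u (g z, z.2)).
  move=> cg z; have c3 : (g w, w.2) @[w --> z] --> (g z, z.2).
    by exact: (cvg_pair (cg z) (c2 z)).
  exact: (cvg_comp _ _ c3 (cu (g z, z.2))).
have cu1 := cuc _ cm.
have cu2 : continuous (fun z : T => mean (fun i => u (z.1 i, z.2))).
  by apply: (@mean_continuous _ T N (fun i z => u (z.1 i, z.2))) => i; exact: cuc.
have cs : continuous (fun z : T => mean (fun i => sqn (z.1 i - vmean z.1))).
  apply: (@mean_continuous _ T N (fun i z => sqn (z.1 i - vmean z.1))) => i z.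
  have c3 : z.1 i - vmean z.1 @[z --> z] --> z.1 i - vmean z.1.
    by apply: cvgB; [exact: cX | exact: cm].
  exact: (cvg_comp _ _ c3 (@sqn_continuous R n _)).
move=> z; apply: cvgD.
  apply: cvgB; first by apply: cvgB; [exact: cu1 | exact: cu2].
  by apply: cvgM; [exact: cvg_cst | exact: cs].
apply: cvgM; first exact: cvg_cst.
apply: cvgM; first exact: c2.
by apply: cvgB; [exact: c2 | exact: cvg_cst].
Qed.

(** Configurations with positive gap have bounded variance, since [u] is bounded and the time term
    is nonpositive. A common integer translation puts their mean in the unit box, so all positive
    values occur on a compact set. *)
Lemma ex_max_gap (R : realType) (n N : nat) (u : 'rV[R]_n * R -> R) (kap dl : R)
    (X0 : 'I_N -> 'rV[R]_n) (t0 : R) :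
  (0 < N)%N -> 0 < kap -> 0 <= dl -> smooth_cylinder u ->
  0 <= t0 <= 1 -> 0 < gap u kap dl X0 t0 ->
  exists (X : 'I_N -> 'rV[R]_n) t, [/\ 0 <= t <= 1, 0 < gap u kap dl X t &
    forall (Y : 'I_N -> 'rV[R]_n) s, 0 <= s <= 1 -> gap u kap dl Y s <= gap u kap dl X t].
Proof.
move=> N0 kap0 dl0 [per su] t01 g0.
pose uc (p : 'rV[R]_n * R) := u (p.1, clamp p.2).
have cuc : continuous uc by exact: smooth_slab_continuous.
have [M HM] : exists M, forall q, slab q -> `|u q| <= M.
  apply: periodic_bounded => //.
    move=> p sp; exists (`|uc p| + 1).
    have /cvgrPdist_le/(_ 1 ltr01) := cuc p; apply: filterS => q Hq sq.
    have -> : u q = uc q by rewrite /uc clamp_id //; case: (q).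
    rewrite -[uc q](subrK (uc p)) addrC.
    by apply: (le_trans (ler_normD _ _)); rewrite lerD2l distrC.
  by move=> k x t st; split=> //; exact: per.
have NR0 : 0 < N%:R :> R by rewrite ltr0n.
(* The variance is at most 4 M / kap, so each squared deviation is at most N times that; r^2 <= z
   implies r <= z + 1, which avoids a square root. *)
pose rho := N%:R * (4 * M / kap) + 1.
have bnd (X : 'I_N -> 'rV[R]_n) t : 0 <= t <= 1 -> 0 < gap u kap dl X t ->
    forall i j, `|X i 0 j - vmean X 0 j| <= rho.
  move=> t1 gpos i j.
  have B x : `|u (x, t)| <= M by exact: HM.
  have Bm : mean (fun i => u (X i, t)) >= - M.
    rewrite -(mean_cst (- M) N0); apply: ler_mean => l.
    by have := B (X l); rewrite ler_norml => /andP[].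
  have Bv : u (vmean X, t) <= M by have := B (vmean X); rewrite ler_norml => /andP[].
  have Bt : dl * (t * (t - 1)) <= 0.
    case/andP: t1 => t0' t1'; rewrite mulr_ge0_le0 // mulr_ge0_le0 //.
    by rewrite subr_le0.
  have ms : mean (fun i => sqn (X i - vmean X)) <= 4 * M / kap.
    rewrite ler_pdivlMr //; move: gpos Bm Bv Bt; rewrite /gap.
    move: (mean (fun i => sqn _)) (mean _) (u _) (dl * _) => a b c d; nra.
  have si : sqn (X i - vmean X) <= N%:R * (4 * M / kap).
    rewrite -ler_pdivrMl //; apply: le_trans ms; rewrite /mean ler_pM2l ?invr_gt0 //.
    by rewrite (bigD1 i) //= lerDl sumr_ge0 // => l _; exact: sqn_ge0.
  have sj : (X i 0 j - vmean X 0 j) ^+ 2 <= N%:R * (4 * M / kap).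
    apply: le_trans si; rewrite /sqn (bigD1 j) //= !mxE lerDl sumr_ge0 // => l _.
    exact: sqr_ge0.
  rewrite /rho; move: sj; rewrite -real_normK ?num_real //.
  move: `|_| (N%:R * _) (normr_ge0 (X i 0 j - vmean X 0 j)) => a b a0; nra.
(* Coordinates of the mean in [0, 1] and deviations at most [rho] give the interval [-rho, rho + 1]
   below. *)
pose T := (prod_topology (fun _ : 'I_N => 'rV[R]_n) * R)%type.
pose box : set T := [set X : prod_topology (fun _ : 'I_N => 'rV[R]_n) | forall i, forall j : 'I_n,
  - rho <= (X i : 'rV[R]_n) 0 j <= rho + 1] `*` `[(0 : R), 1]%classic.
have cbox : compact box.
  apply: compact_setX; last exact: segment_compact.
  apply: (@tychonoff _ (fun _ : 'I_N => 'rV[R]_n)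
    (fun _ => [set v : 'rV[R]_n | forall j, - rho <= v 0 j <= rho + 1])) => i.
  have := rV_compact (fun _ : 'I_n => @segment_compact R (- rho) (rho + 1)).
  by congr compact; apply/seteqP; split=> v /= H j; have := H j; rewrite in_itv.
have into_box (X : 'I_N -> 'rV[R]_n) t : 0 <= t <= 1 -> 0 < gap u kap dl X t ->
    exists2 Y : 'I_N -> 'rV[R]_n, box (Y, t) & gap u kap dl Y t = gap u kap dl X t.
  move=> t1 gpos; have [k Hk] := ex_shift_unit (vmean X).
  have E := gap_shift kap dl X k N0 (per t t1).
  exists (fun i => X i + map_mx intr k); last exact: E.
  split; last by rewrite /= in_itv.
  move=> i j /=; rewrite -E in gpos; have := bnd _ _ t1 gpos i j.
  have := Hk j; rewrite -vmean_shift // => /andP[v0 v1]; rewrite ler_norml => /andP[b0 b1].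
  by apply/andP; split; lra.
have gE (X : 'I_N -> 'rV[R]_n) t : 0 <= t <= 1 -> gap uc kap dl X t = gap u kap dl X t.
  by move=> t1; apply: eq_gap => x; rewrite /uc /= clamp_id.
have [Y0 bY0 gY0] := into_box _ _ t01 g0.
have box0 : box !=set0 by exists (Y0, t0).
have cg : {within box, continuous (fun z : T => gap uc kap dl z.1 z.2)}.
  by apply: continuous_subspaceT; exact: gap_continuous.
have [[X t] /set_mem bXt mx] := compact_EVT_max box0 cbox cg.
have t1 : 0 <= t <= 1 by move: bXt => [_]; rewrite /= in_itv.
have mx' (Y : 'I_N -> 'rV[R]_n) s : box (Y, s) -> gap u kap dl Y s <= gap u kap dl X t.
  move=> bY; have s1 : 0 <= s <= 1 by move: bY => [_]; rewrite /= in_itv.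
  by rewrite -!gE //; apply: (mx (Y, s)); exact: mem_set.
have gpos : 0 < gap u kap dl X t.
  by apply: (lt_le_trans g0); rewrite -gY0; exact: mx'.
exists X, t; split=> // Y s s1.
(* Nonpositive values lie below the positive maximum; the others are attained in the box. *)
have [neg|pos] := leP (gap u kap dl Y s) 0; first exact: le_trans (ltW gpos).
by have [Y' bY' <-] := into_box _ _ s1 pos; exact: mx'.
Qed.

(** * The second-order inequality at a maximum, and two-point configurations *)

Definition dot (R : realFieldType) (n : nat) (v w : 'rV[R]_n) : R := \sum_j v 0 j * w 0 j.

Lemma sqn_line (R : realFieldType) (n : nat) (s : R) (w g : 'rV[R]_n) :
  sqn (w + s *: g) = sqn w + (2 * s * dot w g + s ^+ 2 * sqn g).
Proof.
rewrite /sqn /dot !mulr_sumr -!big_split /=; apply: eq_bigr => j _.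
by rewrite !mxE; ring.
Qed.

Lemma mean_variance (R : realFieldType) (n N : nat) (h : 'I_N -> 'rV[R]_n) :
  (0 < N)%N -> mean (fun i => sqn (h i - vmean h)) = mean (fun i => sqn (h i)) - sqn (vmean h).
Proof.
move=> N0.
have D : mean (fun i => dot (h i) (vmean h)) = sqn (vmean h).
  rewrite /mean /dot /sqn exchange_big mulr_sumr; apply: eq_bigr => j _.
  by rewrite -mulr_suml mulrA -/(mean (fun i => h i 0 j)) -vmeanE expr2.
rewrite (@eq_mean _ _ _ (fun i => sqn (h i) + (- 2 * dot (h i) (vmean h) + sqn (vmean h)))).
  by rewrite !meanD meanZ D mean_cst //; ring.
by move=> i; rewrite -scaleN1r sqn_line; ring.
Qed.

(** Move every X_i along h_i and the time along tau: the mean then moves along the mean of the h_i.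
    The variance identity splits the quadratic term into the [sqn] terms on the two sides. *)
Lemma hess_at_max_gap (R : realType) (n N : nat) (u : 'rV[R]_n * R -> R) (kap dl : R)
    (X h : 'I_N -> 'rV[R]_n) (t tau : R) :
  (0 < N)%N -> smooth_on (@slab R n) u -> 0 < t < 1 ->
  (forall (Y : 'I_N -> 'rV[R]_n) s, 0 <= s <= 1 -> gap u kap dl Y s <= gap u kap dl X t) ->
  hess u (vmean X, t) (vmean h, tau) (vmean h, tau) + kap * sqn (vmean h)
    + 2 * dl * tau ^+ 2 <=
  mean (fun i => hess u (X i, t) (h i, tau) (h i, tau) + kap * sqn (h i)).
Proof.
move=> N0 su t01 mx.
pose w i := X i - vmean X; pose g i := h i - vmean h.
(* [k1] and [k2] are the coefficients of s and s^2 in the variance and time terms of the gap along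
   this line. *)
pose k1 := - kap * mean (fun i => dot (w i) (g i)) + dl * tau * (2 * t - 1).
pose k2 := - (kap / 2) * mean (fun i => sqn (g i)) + dl * tau ^+ 2.
have : hess u (vmean X, t) (vmean h, tau) (vmean h, tau) + 2 * k2 <=
    mean (fun i => hess u (X i, t) (h i, tau) (h i, tau)).
  apply: (@hess_mean_at_max _ _ (@open_slab R n) u N (vmean X, t) (vmean h, tau)
    (fun i => (X i, t)) (fun i => (h i, tau)) k1 k2) => //.
  - exact: open_open_slab.
  - exact: smooth_slab_interior.
  have NS : \forall y \near ((vmean X, t) : 'rV[R]_n * R), open_slab y.
    by apply: open_nbhs_nbhs; split=> //; exact: open_open_slab.
  apply: filterS (near_line (vmean h, tau) NS) => s /open_slab_sub sP.
  have pE (y z : 'rV[R]_n) (a b : R) : (y, a) + s *: (z, b) = (y + s *: z, a + s * b) by [].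
  have vY : vmean (fun i => X i + s *: h i) = vmean X + s *: vmean h.
    by rewrite /vmean big_split /= -scaler_sumr scalerDr !scalerA mulrC.
  have := mx (fun i => X i + s *: h i) (t + s * tau) sP.
  rewrite /gap vY pE.
  rewrite (@eq_mean _ _ (fun i => sqn (X i + s *: h i - (vmean X + s *: vmean h)))
    (fun i => sqn (w i) + (2 * s * dot (w i) (g i) + s ^+ 2 * sqn (g i)))); last first.
    by move=> i; rewrite -sqn_line opprD addrACA scalerBr.
  rewrite !meanD !meanZ /k1 /k2.
  rewrite (@eq_mean _ _ (fun i => u ((X i, t) + s *: (h i, tau)))
    (fun i => u (X i + s *: h i, t + s * tau))) //.
  move: (u _) (u _) (mean _) (mean _) (mean _) (mean _) (mean _) => a b c d e f k.
  lra.
rewrite meanD meanZ /k2 mean_variance //.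
move: (hess _ _ _ _) (mean _) (mean _) (sqn _) => a b c d; lra.
Qed.

Lemma mean_half (R : realFieldType) (m : nat) (a b : R) : (0 < m)%N ->
  mean (fun i : 'I_(m + m) => if (i < m)%N then a else b) = (a + b) / 2.
Proof.
move=> m0; rewrite /mean big_split_ord /= (eq_bigr (fun=> a)); last first.
  by move=> i _; rewrite ltn_ord.
rewrite [X in _ + X](eq_bigr (fun=> b)); last by move=> i _; rewrite ltnNge leq_addr.
rewrite !sumr_const card_ord -mulrnDl -[(a + b) *+ m]mulr_natl natrD.
have : m%:R != 0 :> R by rewrite pnatr_eq0 -lt0n.
by move=> mn0; field; rewrite -mulr2n mulrn_eq0 negb_or.
Qed.

(** Half of the points at x + v and half at x - v: a failure of midpoint convexity gives a positive
    gap for every even number of points, however large. *)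
Lemma gap_pm (R : realType) (n m : nat) (u : 'rV[R]_n * R -> R) kap dl
    (x v : 'rV[R]_n) (t : R) : (0 < m)%N ->
  gap u kap dl (fun i : 'I_(m + m) => if (i < m)%N then x + v else x - v) t =
  u (x, t) - (u (x + v, t) + u (x - v, t)) / 2 - kap / 2 * sqn v + dl * (t * (t - 1)).
Proof.
move=> m0; rewrite /gap.
have -> : vmean (fun i : 'I_(m + m) => if (i < m)%N then x + v else x - v) = x.
  apply/rowP => j; rewrite vmeanE.
  rewrite (@eq_mean _ _ _ (fun i : 'I_(m + m) => if (i < m)%N then (x + v) 0 j else (x - v) 0 j)).
    by rewrite mean_half // !mxE; lra.
  by move=> i; case: ifP.
congr (_ - _ - _ * _ + _).
  rewrite -(mean_half _ _ m0); apply: eq_mean => i; by case: ifP.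
have -> : sqn v = (sqn v + sqn v) / 2 by lra.
rewrite -(mean_half _ _ m0); apply: eq_mean => i; case: ifP => _.
  by rewrite addrC addKr.
by rewrite addrC addKr -scaleN1r sqnZ sqrrN expr1n mul1r.
Qed.

Lemma hess_bounded (R : realType) (n : nat) (u : 'rV[R]_n * R -> R) v w :
  smooth_cylinder u ->
  exists2 C, 0 <= C & forall q, open_slab q -> `|hess u q v w| <= C.
Proof.
move=> [per su].
have [C HC] : exists C, forall q, open_slab q -> `|hess u q v w| <= C.
  apply: periodic_bounded.
  - exact: open_slab_sub.
  - by move=> p; exact: hess_locally_bounded.
  - by move=> k x t ot; split; [exact: ot | exact: (hess_periodic v w k x per ot)].
exists C => //; apply: le_trans (HC (0, 1 / 2) _) => //.
by rewrite /open_slab /=; apply/andP; split; lra.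
Qed.

Lemma gap_endpoint_le0 (R : realType) (n N : nat) (u : 'rV[R]_n * R -> R) (f : 'rV[R]_n -> R)
    (kap dl t : R) (X : 'I_N -> 'rV[R]_n) :
  (0 < N)%N -> Ck 2 setT f -> (forall y v, - (kap * sqn v) <= hess f y v v) ->
  (forall x, u (x, t) = f x) -> t * (t - 1) = 0 -> gap u kap dl X t <= 0.
Proof.
move=> N0 Cf Hf uf tt; have := jensen_semiconvex X N0 Cf Hf.
rewrite /gap tt mulr0 uf (@eq_mean _ _ (fun i => u (X i, t)) (fun i => f (X i))) //.
by move: (f _) (mean _) (mean _) => a b c; lra.
Qed.

(** The midpoint inequality says that s = 0 maximizes the centred second difference corrected by a
    multiple of s^2, so the second derivative test applies. *)
Lemma hess_ge_of_midpoint (R : realType) (n : nat) (u : 'rV[R]_n * R -> R) (kap : R)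
    (x v : 'rV[R]_n) (t : R) :
  smooth_on (@slab R n) u -> 0 < t < 1 ->
  (forall s : R, u (x, t) - (u (x + s *: v, t) + u (x - s *: v, t)) / 2
     - kap / 2 * sqn (s *: v) <= 0) ->
  - (kap * sqn v) <= hess u (x, t) (v, 0) (v, 0).
Proof.
move=> su t01 H.
have conclude (a b : R) : 0 + 2 * - (kap / 2 * b) <= a -> - (kap * b) <= a by lra.
have shift0 (a b c d : R) : a - b - kap / 2 * (d ^+ 2 * c) <= 0 ->
    a - b + (0 * d + - (kap / 2 * c) * d ^+ 2) <= 0 by lra.
have Cu := smooth_slab_interior su.
have oS := @open_open_slab R n.
(* Two points leave x in the opposite directions v and -v, while the centre stays fixed with
   direction 0. *)
pose w (i : 'I_(1 + 1)) : 'rV[R]_n * R := if (i < 1)%N then (v, 0) else (-1) *: (v, 0).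
have := @hess_mean_at_max _ _ (@open_slab R n) u (1 + 1) (x, t) 0 (fun=> (x, t)) w
  0 (- (kap / 2 * sqn v)) oS Cu t01 (fun=> t01).
have h0 : hess u (x, t) 0 0 = 0.
  by rewrite -(scale0r (0 : 'rV[R]_n * R)) (hessZr _ _ _ (t01 : open_slab (x, t)) Cu) mul0r.
rewrite h0 (@eq_mean _ _ (fun i => hess u (x, t) (w i) (w i))
    (fun=> hess u (x, t) (v, 0) (v, 0))); last first.
  move=> i; rewrite /w; case: ifP => [//|_].
  rewrite (hessZr _ _ _ (t01 : open_slab (x, t)) Cu).
  by rewrite (hessZl _ _ _ oS (t01 : open_slab (x, t)) Cu) !mulN1r opprK.
rewrite !mean_cst // => H2.
apply: conclude; apply: H2; near=> s.
have := H s; rewrite sqnZ scaler0 addr0.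
rewrite (@eq_mean _ _ (fun i => u ((x, t) + s *: w i))
  (fun i : 'I_(1 + 1) => if (i < 1)%N then u (x + s *: v, t) else u (x - s *: v, t))).
  by rewrite mean_half // subrr => Hs; exact: shift0.
move=> i; rewrite /w; case: ifP => _; congr u; apply/pair_equal_spec; split => /=.
- by [].
- by rewrite scaler0 addr0.
- by rewrite scaleN1r scalerN.
- by rewrite !scaler0 addr0.
Unshelve. all: by end_near. Qed.

(* The planar algebra serves both dimensions: [E0, E1] is the standard basis and
   [g = 1] if [n = 2], while [E1 = 0] and [g = 0] if [n = 1]. *)
Lemma donaldson_semiconvex (R : realType) (n : nat) (eps lam g : R)
    (u0 u1 : 'rV[R]_n -> R) (u : 'rV[R]_n * R -> R) (E0 E1 : 'rV[R]_n) :
  0 < eps -> 0 < lam -> lam < 1 -> 0 <= g <= 1 -> n%:R = 1 + g ->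
  (forall x y, sqn (x *: E0 + y *: E1) = x ^+ 2 + g * y ^+ 2) ->
  (forall p, laplacian_x u p = hess u p (E0, 0) (E0, 0) + hess u p (E1, 0) (E1, 0)) ->
  (forall p, \sum_(j < n) dx j (dt u) p ^+ 2 =
     hess u p (0, 1) (E0, 0) ^+ 2 + hess u p (0, 1) (E1, 0) ^+ 2) ->
  Ck 2 setT u0 -> Ck 2 setT u1 ->
  (forall y v, - ((1 - lam) * sqn v) <= hess u0 y v v) ->
  (forall y v, - ((1 - lam) * sqn v) <= hess u1 y v v) ->
  donaldson_solution eps u0 u1 u ->
  forall x t v, 0 < t < 1 -> - ((1 - lam) * sqn v) <= hess u (x, t) (v, 0) (v, 0).
Proof.
move=> eps0 lam0 lam1 /andP[g0 g1] ng Eg lapE gradE Cu0 Cu1 H0 H1 [cyl pde adm b0 b1].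
move=> x t v t01.
have ar_beta (b q : R) : 0 < b -> - 1 <= q -> 0 < b + b / 2 * q.
  move=> b_gt0 q1; have : 0 <= b / 2 * (q + 1) by apply: mulr_ge0; lra.
  lra.
have ar_eq (r q : R) : r = q -> r <= q by move=> ->.
have ar_time (r : R) : - 1 <= r * (r - 1) by have := sqr_ge0 (2 * r - 1); lra.
have ar_trace (h1 h2 : R) : 1 + g + (h1 + h2) =
    h1 + (1 - lam) + (h2 + (1 - lam) * g) + (1 + g) * lam by ring.
have ar_pos (q1 q2 q3 : R) : q1 - (q2 + q3) = eps -> 0 <= q2 -> 0 <= q3 -> 0 < q1 by lra.
have ar_form (C0 C1 C2 C3 k h1 h2 h3 y z : R) : 0 <= C0 -> 0 <= C2 -> 0 <= C3 -> 0 < k ->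
    h1 <= C0 -> `|h2| <= C1 -> h3 <= C2 ->
    qform2 (h1 + k) h2 (h3 + k * g) y z <= (C0 + C1 + C2 + C3 + k) * (y ^+ 2 + z ^+ 2).
  move=> C0p C2p C3p kp k1; rewrite ler_norml => /andP[k2' k2] k3.
  have i1 := ler_wpM2r (sqr_ge0 y) k1; have i3 := ler_wpM2r (sqr_ge0 z) k3.
  have j1 : 0 <= (C1 - h2) * (y + z) ^+ 2 by rewrite mulr_ge0 ?sqr_ge0 ?subr_ge0.
  have j2 : 0 <= (C1 + h2) * (y - z) ^+ 2 by rewrite mulr_ge0 ?sqr_ge0 //; lra.
  have l1 := mulr_ge0 C3p (sqr_ge0 y); have l2 := mulr_ge0 C3p (sqr_ge0 z).
  have l3 := mulr_ge0 C2p (sqr_ge0 y); have l4 := mulr_ge0 C0p (sqr_ge0 z).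
  have l5 : 0 <= k * (1 - g) * z ^+ 2.
    by apply: mulr_ge0; [apply: mulr_ge0; [exact: ltW | rewrite subr_ge0] | exact: sqr_ge0].
  rewrite /qform2; lra.
have su : smooth_on (@slab R n) u := cyl.2.
have Cu := smooth_slab_interior su.
have oS := @open_open_slab R n.
set kap := 1 - lam in H0 H1 *.
have kap0 : 0 < kap by rewrite subr_gt0.
have t01' : 0 <= t <= 1 := open_slab_sub (t01 : open_slab (x, t)).
apply: hess_ge_of_midpoint => // s; rewrite leNgt; apply/negP => beta0.
set beta := (X in 0 < X) in beta0.
pose e0 : 'rV[R]_n * R := (E0, 0); pose e1 : 'rV[R]_n * R := (E1, 0).
pose et : 'rV[R]_n * R := (0, 1).
have [C00 C000 HC00] := hess_bounded e0 e0 cyl.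
have [C01 C010 HC01] := hess_bounded e0 e1 cyl.
have [C11 C110 HC11] := hess_bounded e1 e1 cyl.
have [Ctt Ctt0 HCtt] := hess_bounded et et cyl.
(* One constant bounds both the time entries and the spatial forms; [kap] covers the shift by kap
   |x|^2 / 2. *)
pose K := C00 + C01 + C11 + Ctt + kap.
have K0 : 0 < K by rewrite ltr_wpDl // !addr_ge0.
(* Since t (t - 1) >= -1, the gap of the two-point configuration stays at least beta / 2. *)
pose dl := beta / 2; have dl0 : 0 < dl by rewrite divr_gt0.
(* Half of the largest value allowed by eta K^2 <= dl eps. *)
pose eta := dl * eps / (2 * K ^+ 2).
have eta0 : 0 < eta by rewrite divr_gt0 ?mulr_gt0 ?exprn_gt0.
have etaK : eta * K ^+ 2 < dl * eps.
  have -> : eta * K ^+ 2 = dl * eps / 2 by rewrite /eta; field; rewrite gt_eqF.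
  by rewrite ltr_pdivrMr // ltr_pMr ?mulr_gt0 // ltr1n.
(* Then K / eta < m <= 2 m - 1, which is the number of points minus one. *)
pose m := (Num.truncn (K / eta)).+1.
have Keta : K < eta * (m + m).-1%:R.
  rewrite mulrC -ltr_pdivrMr //.
  apply: lt_le_trans (truncnS_gt _) _.
  by rewrite ler_nat /m addSn /= leq_addl.
have N0 : (0 < m + m)%N by rewrite addSn.
have N1 : (1 < m + m)%N by rewrite addSn addnS.
have gpos : 0 < gap u kap dl (fun i : 'I_(m + m) => if (i < m)%N then x + s *: v else x - s *: v) t.
  rewrite gap_pm // -/beta.
  exact: ar_beta.
have [X [t' [t'01 gX mx]]] := ex_max_gap N0 kap0 (ltW dl0) cyl t01' gpos.
(* At the end times the time term vanishes and Jensen's inequality for the data makes the gap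
   nonpositive. *)
have t1 : 0 < t' < 1.
  case/andP: t'01 => a b; rewrite !lt_neqAle a b !andbT; apply/andP; split.
    apply/eqP => t'0; move: gX; rewrite -t'0 ltNge.
    by rewrite (gap_endpoint_le0 _ _ N0 Cu0 H0 b0) // mul0r.
  apply/eqP => t'0; move: gX; rewrite t'0 ltNge.
  by rewrite (gap_endpoint_le0 _ _ N0 Cu1 H1 b1) // subrr mulr0.
(* Entries of the second derivative of u + kap |x|^2 / 2 along [e0], [e1], [et]; the factor g
   removes the shift from the void direction when n = 1. *)
pose a p := hess u p e0 e0 + kap.
pose b p := hess u p e0 e1.
pose c p := hess u p e1 e1 + kap * g.
pose p1 p := hess u p et e0.
pose p2 p := hess u p et e1.
pose d p := hess u p et et.
have formE p y z r : open_slab p ->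
    hess u p (y *: E0 + z *: E1, r) (y *: E0 + z *: E1, r) + kap * sqn (y *: E0 + z *: E1) =
    qform3 (a p) (b p) (c p) (p1 p) (p2 p) (d p) y z r.
  move=> op.
  have -> : (y *: E0 + z *: E1, r) = y *: e0 + z *: e1 + r *: et.
    by apply/pair_equal_spec; split; rewrite /= ?scaler0 ?addr0 // !add0r [RHS]mulr1.
  rewrite !(hessDr _ _ _ oS op Cu) !(hessDl _ _ _ oS op Cu).
  rewrite !(hessZr _ _ _ op Cu) !(hessZl _ _ _ oS op Cu).
  rewrite (hessC e1 e0 oS op Cu) (hessC e0 et oS op Cu) (hessC e1 et oS op Cu) Eg.
  rewrite /qform3 /qform2 /a /b /c /p1 /p2 /d.
  move: (hess u p e0 e0) (hess u p e0 e1) (hess u p e1 e1) (hess u p et e0)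
    (hess u p et e1) (hess u p et et) => h1 h2 h3 h4 h5 h6.
  by ring.
(* The trace identity n + Delta u = a + c + n lam uses n = 1 + g. Positivity of d follows since its
   product with this nonnegative factor is at least eps. *)
have PDE p : open_slab p ->
    d p * (a p + c p + n%:R * lam) - (p1 p ^+ 2 + p2 p ^+ 2) = eps /\ 0 < d p.
  case: p => y r op; have := pde y r op; have := adm y r op.
  rewrite /donaldson_op gradE lapE -/e0 -/e1 -/et.
  have -> : dt (dt u) (y, r) = d (y, r) by [].
  have -> : n%:R + (hess u (y, r) e0 e0 + hess u (y, r) e1 e1) =
    a (y, r) + c (y, r) + n%:R * lam by rewrite ng; exact: ar_trace.
  move=> ad E; split=> //.
  have : 0 < d (y, r) * (a (y, r) + c (y, r) + n%:R * lam).
    by apply: (ar_pos _ _ _ E); exact: sqr_ge0.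
  by rewrite mulrC; move: ad; rewrite le0r => /orP[/eqP->|ad]; rewrite ?mul0r ?ltxx ?pmulr_rgt0.
have dK p : open_slab p -> d p <= K.
  move=> op; apply: le_trans (ler_norm _) (le_trans (HCtt p op) _).
  by apply: ler_wpDr (ltW kap0) _; apply: ler_wpDl => //; rewrite !addr_ge0.
have qK p y z : open_slab p -> qform2 (a p) (b p) (c p) y z <= K * (y ^+ 2 + z ^+ 2).
  move=> op; apply: ar_form => //; [|exact: HC01|].
    by apply: le_trans (HC00 p op); exact: ler_norm.
  by apply: le_trans (HC11 p op); exact: ler_norm.
have oX i : open_slab (X i, t') by [].
have oV : open_slab (vmean X, t') by [].
apply: (@no_strict_touching R (m + m) (n%:R * lam) eps dl K eta (fun i => a (X i, t'))
  (fun i => b (X i, t')) (fun i => c (X i, t')) (fun i => p1 (X i, t')) (fun i => p2 (X i, t'))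
  (fun i => d (X i, t')) (a (vmean X, t')) (b (vmean X, t')) (c (vmean X, t'))
  (p1 (vmean X, t')) (p2 (vmean X, t')) (d (vmean X, t'))) => //.
- by rewrite mulr_gt0 // ng ltr_pwDl.
- by move=> i; case: (PDE _ (oX i)).
- by move=> i; exact: dK.
- by move=> i y z; exact: qK.
- by case: (PDE _ oV).
- by rewrite (PDE _ oV).2 dK.
move=> h k r.
have := hess_at_max_gap (fun i => h i *: E0 + k i *: E1) r N0 su t1 mx.
have -> : vmean (fun i => h i *: E0 + k i *: E1) = mean h *: E0 + mean k *: E1.
  by rewrite /vmean /mean big_split /= scalerDr -!scaler_suml !scalerA.
move=> H; apply: le_trans (le_trans _ H) _.
  by rewrite lerD2r; exact: ar_eq (esym (formE _ (mean h) (mean k) r oV)).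
by apply: ler_mean => i; exact: ar_eq (formE _ (h i) (k i) r (oX i)).
Qed.

(** * Reduction to constants below one, and conclusion in dimensions one and two *)

(** Apply Jensen's inequality to the two points at plus and minus a unit lattice vector: by
    periodicity the values of f cancel and only -kap / 2 <= 0 remains. This gives lambda <= 1. *)
Lemma semiconvex_periodic (R : realType) (n : nat) (f : 'rV[R]_n.+1 -> R) (kap : R) :
  Zperiodic f -> Ck 2 setT f -> (forall y v, - (kap * sqn v) <= hess f y v v) -> 0 <= kap.
Proof.
move=> per Cf Hf.
pose k : 'rV[int]_n.+1 := delta_mx 0 0.
have := @gap_endpoint_le0 R _ (1 + 1) (fun p => f p.1) f kap 0 0
  (fun i => if (i < 1)%N then 0 + map_mx intr k else 0 - map_mx intr k)
  isT Cf Hf (fun=> erefl) (mul0r _).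
rewrite gap_pm //= per -raddfN /= per mul0r.
have -> : sqn (map_mx intr k : 'rV[R]_n.+1) = 1.
  rewrite map_delta_mx /sqn (bigD1 ord0) //= mxE !eqxx expr1n big1 ?addr0 // => j /negbTE j0.
  by rewrite mxE j0 andbF expr0n.
by lra.
Qed.

Lemma mx_ge_hess (R : realType) (n : nat) (f : 'rV[R]_n -> R) (lam : R) :
  Ck 2 setT f -> (forall x, mx_ge (hessian f x + 1%:M) lam%:M) ->
  forall x v, - ((1 - lam) * sqn v) <= hess f x v v.
Proof.
move=> Cf H x v; have [_ /(_ v)] := H x.
by rewrite mx_form_shift hessianE // -lerBlDr sub0r.
Qed.

(** Covers lambda = 1: the gap argument needs 1 - l > 0, so it is run for l < lambda and the bound
    is closed by continuity in l. *)
Lemma semiconvex_limit (R : realType) (lam s H : R) :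
  0 < lam -> 0 <= s ->
  (forall l, 0 < l -> l < lam -> - ((1 - l) * s) <= H) -> - ((1 - lam) * s) <= H.
Proof.
move=> lam0 s0 HH; rewrite leNgt; apply/negP => lt.
pose D := - ((1 - lam) * s) - H; have D0 : 0 < D by rewrite subr_gt0.
(* The first bound keeps lam - e positive, the second keeps e s below the supposed defect [D]. *)
pose e := Num.min (lam / 2) (D / (2 * (s + 1))).
have s1 : 0 < 2 * (s + 1) by lra.
have e0 : 0 < e by rewrite lt_min !divr_gt0.
have e1 : e <= lam / 2 by rewrite ge_min lexx.
have e2 : e * (2 * (s + 1)) <= D by rewrite -ler_pdivlMr // ge_min lexx orbT.
have es : 0 <= e * s by rewrite mulr_ge0 // ltW.
have : - ((1 - (lam - e)) * s) <= H by apply: HH; lra.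
rewrite /D in e2; lra.
Qed.

Theorem theorem2 (R : realType) (n : nat) (eps lambda : R)
    (u0 u1 : 'rV[R]_n -> R) (u : 'rV[R]_n * R -> R) :
  n = 1%N \/ n = 2%N ->
  0 < eps ->
  0 < lambda ->
  smooth_torus u0 ->
  smooth_torus u1 ->
  (forall x : 'rV[R]_n, mx_ge (hessian u0 x + 1%:M) lambda%:M) ->
  (forall x : 'rV[R]_n, mx_ge (hessian u1 x + 1%:M) lambda%:M) ->
  donaldson_solution eps u0 u1 u ->
  forall (x : 'rV[R]_n) (t : R), 0 < t < 1 ->
    mx_ge (hessian_x u (x, t) + 1%:M) lambda%:M.
Proof.
move=> n12 eps0 lam0 [per0 su0] [per1 su1] H0 H1 sol x t t01.
have su : smooth_on (@slab R n) u by case: sol => -[].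
have Cu := smooth_slab_interior su.
have oS := @open_open_slab R n.
have op : open_slab (x, t) by [].
have B0 := mx_ge_hess (su0 2%N) H0.
have B1 := mx_ge_hess (su1 2%N) H1.
split.
  rewrite !linearB /= linearD /= trmx1 tr_scalar_mx; congr (_ + _ - _).
  by apply/matrixP => i j; rewrite !mxE; exact: (hessC _ _ oS op Cu).
move=> v; rewrite mx_form_shift (hessian_xE _ oS op Cu) -lerBlDr sub0r.
have lam1 : lambda <= 1.
  rewrite -subr_ge0; case: n12 => En; subst n.
    exact: (semiconvex_periodic per0 (su0 2%N) B0).
  exact: (semiconvex_periodic per0 (su0 2%N) B0).
apply: semiconvex_limit => // [|l l0 ll]; first exact: sqn_ge0.
have weaken (f : 'rV[R]_n -> R) : (forall y v, - ((1 - lambda) * sqn v) <= hess f y v v) ->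
    forall y v, - ((1 - l) * sqn v) <= hess f y v v.
  move=> Bf y w; apply: le_trans (Bf y w).
  by rewrite lerN2 ler_wpM2r ?sqn_ge0 // lerD2l lerN2 ltW.
have l1 : l < 1 by exact: lt_le_trans lam1.
(* For n = 1 the second planar direction is the zero vector, and its terms have to vanish. *)
have hess0 p (w : 'rV[R]_n * R) : hess u p w (0, 0) = 0.
  have -> : (0, 0) = 0 :> 'rV[R]_n * R by [].
  by rewrite /hess derive0.
case: n12 => En; subst n.
- apply: (@donaldson_semiconvex R 1 eps l 0 u0 u1 u (delta_mx 0 ord0) 0 eps0 l0 l1
    _ _ _ _ _ (su0 2%N) (su1 2%N) (weaken _ B0) (weaken _ B1) sol x t v t01).
  + by rewrite lexx ler01.
  + by rewrite addr0.
  + by move=> y z; rewrite /sqn big_ord_recl big_ord0 !mxE !eqxx /=; ring.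
  + move=> p; apply: etrans (congr1 (+%R _) (esym (hess0 p (0, 0)))).
    by rewrite /laplacian_x big_ord_recl big_ord0.
  + move=> p; apply: etrans (congr1 (fun z => _ + z ^+ 2) (esym (hess0 p (0, 1)))).
    by rewrite big_ord_recl big_ord0 expr0n.
- apply: (@donaldson_semiconvex R 2 eps l 1 u0 u1 u (delta_mx 0 ord0)
    (delta_mx 0 (lift ord0 ord0)) eps0 l0 l1
    _ _ _ _ _ (su0 2%N) (su1 2%N) (weaken _ B0) (weaken _ B1) sol x t v t01).
  + by rewrite ler01 lexx.
  + by [].
  + by move=> y z; rewrite /sqn !big_ord_recl big_ord0 !mxE -!val_eqE /=; ring.
  + by move=> p; rewrite /laplacian_x big_ord_recl big_ord1.
  + by move=> p; rewrite big_ord_recl big_ord1.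
Qed.
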